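(* Let $m\ge 2$ and let $\mathfrak{d}_{2m+2}=\mathbb{R}\cdot\delta_\lambda\oplus V_{2m}\oplus\mathbb{R}\cdot\delta_\lambda^*$ be the real oscillator Lie algebra attached to the $m$-tuple $\lambda=(1,\dots,1)$, with invariant form $\varphi_{0,1}$, and write $z=\delta_\lambda^*$. Let $\mathfrak{s}$ and $\mathfrak{s}_0$ be the Lie algebras of linear maps of $\mathfrak{d}_{2m+2}$ described in the context. Then: (a) $\operatorname{Der}\mathfrak{d}_{2m+2}=\mathbb{R}\cdot D_{1,0,0}\oplus\mathbb{R}\cdot D_{0,1,2}\oplus[\mathfrak{s},\mathfrak{s}]\oplus\operatorname{Inner}\mathfrak{d}_{2m+2}$ (direct sum of vector spaces), where $D_{0,1,2}$ is the derivation given by $D_{0,1,2}(\delta_\lambda)=0$, $D_{0,1,2}(v)=v$ for all $v\in V_{2m}$ and $D_{0,1,2}(z)=2z$, and $D_{1,0,0}$ is the derivation given by $D_{1,0,0}(\delta_\lambda)=z$ and $D_{1,0,0}([\mathfrak{d}_{2m+2},\mathfrak{d}_{2m+2}])=0$. (b) $\operatorname{Der}_{\varphi_{0,1}}\mathfrak{d}_{2m+2}=\mathfrak{s}\oplus[\operatorname{Inner}\mathfrak{d}_{2m+2},\operatorname{Inner}\mathfrak{d}_{2m+2}]$ (direct sum of vector spaces), and $\mathfrak{s}^2=[\mathfrak{s},\mathfrak{s}]$ is isomorphic to the special unitary simple real Lie algebra $\mathfrak{su}_m(\mathbb{R})$. For $m\ge 3$, $\mathfrak{s}_0$ is (isomorphic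 to) the orthogonal simple Lie algebra of real $m\times m$ skew-symmetric matrices. For $m=1$, with the same definitions of $\mathfrak{d}_4$, $\varphi_{0,1}$, $D_{0,1,2}$ and $D_{1,0,0}$, one has $\operatorname{Der}\mathfrak{d}_4=\mathbb{R}\cdot D_{0,1,2}\oplus\mathbb{R}\cdot D_{1,0,0}\oplus\operatorname{Inner}\mathfrak{d}_4$ and $\operatorname{Der}_{\varphi_{0,1}}\mathfrak{d}_4=\operatorname{Inner}\mathfrak{d}_4$.
   Context: For $m\ge1$, the real oscillator algebra $\mathfrak{d}_{2m+2}=\mathfrak{d}_{2m+2}(1,\dots,1)$ is the real Lie algebra with basis $\delta_\lambda,x_1,\dots,x_m,y_1,\dots,y_m,z=\delta_\lambda^*$ and brackets (up to skew-symmetry) $[\delta_\lambda,x_i]=y_i$, $[\delta_\lambda,y_i]=-x_i$, $[x_i,y_i]=z$ for $1\le i\le m$, all other brackets of basis elements being zero. Here $V_{2m}=\operatorname{span}\langle x_1,\dots,x_m,y_1,\dots,y_m\rangle$. The symmetric bilinear form $\varphi_{0,1}$ is defined by: $\{x_1,\dots,x_m,y_1,\dots,y_m\}$ is an orthonormal family, $V_{2m}$ is orthogonal to $\operatorname{span}\langle\delta_\lambda,z\rangle$, $\varphi_{0,1}(\delta_\lambda,\delta_\lambda)=\varphi_{0,1}(z,z)=0$ and $\varphi_{0,1}(\delta_\lambda,z)=1$. It is invariant and nondegenerate. For a Lie algebra $\mathfrak{g}$ with invariant form $\varphi$: $\operatorname{Der}\mathfrak{g}$ is the Lie algebra of derivations,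 $\operatorname{Inner}\mathfrak{g}=\{\operatorname{ad}x: x\in\mathfrak{g}\}$ with $\operatorname{ad}x(y)=[x,y]$, and $\operatorname{Der}_\varphi\mathfrak{g}$ is the Lie algebra of derivations $d$ with $\varphi(d(x),y)+\varphi(x,d(y))=0$ for all $x,y\in\mathfrak{g}$. Brackets of linear maps are commutators. $\mathfrak{s}$ is the Lie algebra (under the commutator) of all $2m\times 2m$ real block matrices $\begin{pmatrix} M&P\\-P&M\end{pmatrix}$ with $M,P$ real $m\times m$ matrices, $M^t=-M$ and $P^t=P$. Each such matrix is identified with the linear map of $\mathfrak{d}_{2m+2}$ which acts on $V_{2m}$ by this matrix with respect to the ordered basis $x_1,\dots,x_m,y_1,\dots,y_m$ and which sends $\delta_\lambda$ and $z$ to $0$. $\mathfrak{s}_0\subseteq\mathfrak{s}$ is the subalgebra of those matrices with $P=0$. $\mathfrak{su}_m(\mathbb{R})$ denotes the real Lie algebra of traceless skew-Hermitian complex $m\times m$ matrices.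
   Formalization: Simplicity of the orthogonal Lie algebra of real skew-symmetric m×m matrices is asserted for m≥3 with m≠4, since for m=4 it is so(3)⊕so(3) and not simple; the isomorphism with s_0 is still stated for all m≥3. *)

(* Defs.v *)
From HB Require Import structures.
From mathcomp Require Import all_boot all_order all_algebra.
From mathcomp Require Import complex ring.
From mathcomp Require Import boolp reals.

Set Implicit Arguments.
Unset Strict Implicit.
Unset Printing Implicit Defensive.

Import GRing.Theory.
Local Open Scope ring_scope.

Section SubspaceComprehension.
Variables (K : fieldType) (V : vectType K).
Implicit Types P : V -> Prop.

Definition is_subspace P :=
  P 0 /\ forall (a : K) (u v : V), P u -> P v -> P (a *: u + v).

Lemma is_subspace_vspace P :
  is_subspace P -> exists U : {vspace V}, forall v, v \in U <-> P v.
Proof.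
move=> [P0 PL].
pose Q n := `[< exists U : {vspace V}, \dim U = n /\ forall v, v \in U -> P v >].
have exQ : exists n, Q n.
  exists 0%N; apply/asboolP; exists 0%VS; rewrite dimv0; split=> // v.
  by rewrite memv0 => /eqP->.
have bQ n : Q n -> (n <= \dim {:V})%N.
  by move=> /asboolP[U [<- _]]; apply: dimvS; apply: subvf.
case: (ex_maxnP exQ bQ) => n /asboolP[U [dU UP]] maxn; exists U => v; split; first exact: UP.
move=> Pv; pose W := (<[v]> + U)%VS.
have WP w : w \in W -> P w.
  by case/memv_addP=> _ /vlineP[a ->] [u /UP Pu ->]; apply: PL.
have : U == W.
  rewrite eqEdim addvSr /= dU; apply: maxn; apply/asboolP.
  by exists W.
move/eqP=> ->; apply: (subvP (addvSl _ _)); exact: memv_line.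
Qed.

(* Subspaces given by a comprehension; membership is [mem_vspace_of]. *)
Definition vspace_of P (hP : is_subspace P) : {vspace V} :=
  projT1 (cid (is_subspace_vspace hP)).

Lemma mem_vspace_of P (hP : is_subspace P) v : v \in vspace_of hP <-> P v.
Proof. exact: (projT2 (cid (is_subspace_vspace hP))). Qed.

End SubspaceComprehension.

HB.mixin Record Vector_isLie (K : fieldType) L of Vector K L := {
  lie : L -> L -> L;
  lie_linearl : forall (a : K) (x y z : L),
    lie (a *: x + y) z = a *: lie x z + lie y z;
  lie_linearr : forall (z : L) (a : K) (x y : L),
    lie z (a *: x + y) = a *: lie z x + lie z y;
  liexx : forall x : L, lie x x = 0;
  lie_jacobi : forall x y z : L,
    lie x (lie y z) + lie y (lie z x) + lie z (lie x y) = 0 }.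

#[short(type="lieType")]
HB.structure Definition Lie (K : fieldType) :=
  { L of Vector K L & Vector_isLie K L }.

HB.instance Definition _ (K : fieldType) (L : lieType K) (x : L) :=
  GRing.isLinear.Build K L L *:%R (lie x) (lie_linearr x).

Section LieTheory.
Variables (K : fieldType) (L : lieType K).
Implicit Types (x y : L) (U V W I : {vspace L}).

Lemma lieDl x y z : lie (x + y) z = lie x z + lie y z.
Proof. by have := lie_linearl 1 x y z; rewrite !scale1r. Qed.

Lemma lieC x y : lie x y = - lie y x.
Proof.
have := liexx (x + y); rewrite lieDl !linearD /= !liexx add0r addr0.
by move/eqP; rewrite addr_eq0 => /eqP.
Qed.

Lemma lie0l x : lie 0 x = 0. Proof. by rewrite lieC linear0 oppr0. Qed.

Lemma lieZl a x y : lie (a *: x) y = a *: lie x y.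
Proof. by rewrite lieC linearZ /= -scalerN -lieC. Qed.

(* [U, V] is the linear span of the brackets; see [mem_lie_prod] and
   [lie_prodP]. *)
Definition lie_prod U V : {vspace L} :=
  <<allpairs lie (vbasis U) (vbasis V)>>%VS.

Lemma mem_lie_prod U V x y : x \in U -> y \in V -> lie x y \in lie_prod U V.
Proof.
move=> /coord_vbasis-> /coord_vbasis->; rewrite linear_sum /=.
apply: memv_suml => j _; rewrite linearZ /= memvZ // lieC memvN linear_sum /=.
apply: memv_suml => i _; rewrite linearZ /= memvZ // lieC memvN.
by rewrite memv_span //; apply/allpairsP; exists ((vbasis U)`_i, (vbasis V)`_j);
  rewrite !memt_nth.
Qed.

Lemma lie_prodP U V W :
  reflect {in U & V, forall x y, lie x y \in W} (lie_prod U V <= W)%VS.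
Proof.
apply: (iffP idP) => [/subvP sUVW x y Ux Vy | sUVW].
  by apply: sUVW; apply: mem_lie_prod.
apply/span_subvP=> _ /allpairsP[[u v] /= [Uu Vv ->]].
by rewrite sUVW // vbasis_mem.
Qed.

Definition lie_subalg U := (lie_prod U U <= U)%VS.

Definition lie_ideal U I := (I <= U)%VS /\ (lie_prod U I <= I)%VS.

Definition lie_simple U :=
  [/\ lie_subalg U, lie_prod U U != 0%VS
    & forall I, lie_ideal U I -> I = 0%VS \/ I = U].

Definition is_derivation (d : 'End(L)) :=
  forall x y, d (lie x y) = lie (d x) y + lie x (d y).

Fact is_derivation_subspace : is_subspace is_derivation.
Proof.
split=> [x y | a d e dd de x y].
  by rewrite !zero_lfunE linear0 lie0l addr0.
rewrite !add_lfunE !scale_lfunE dd de lie_linearl lie_linearr scalerDr.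
by rewrite addrACA.
Qed.

Definition Der : {vspace 'End(L)} := vspace_of is_derivation_subspace.

Definition ad x : 'End(L) := linfun (lie x).

Fact inner_subspace : is_subspace (fun d : 'End(L) => exists x, d = ad x).
Proof.
split; first by exists 0; apply/lfunP=> y; rewrite zero_lfunE lfunE /= lie0l.
move=> a _ _ [x ->] [x' ->]; exists (a *: x + x'); apply/lfunP=> y.
by rewrite add_lfunE scale_lfunE !lfunE /= lie_linearl.
Qed.

Definition Inner : {vspace 'End(L)} := vspace_of inner_subspace.

End LieTheory.

Arguments Der {K} L.
Arguments Inner {K} L.

(* A linear map between two subspaces always extends to the ambient spaces, so
   [f] is taken on the ambient spaces. *)
Definition lie_isomorphic (K : fieldType) (L1 L2 : lieType K)
    (U1 : {vspace L1}) (U2 : {vspace L2}) :=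
  [/\ lie_subalg U1, lie_subalg U2 &
    exists f : 'Hom(L1, L2),
      [/\ {in U1 &, injective f}, (f @: U1)%VS = U2
        & {in U1 &, forall x y, f (lie x y) = lie (f x) (f y)}]].

Lemma jacobi_cancel (V : zmodType) (a b c d e i : V) :
  a - b - (c - d) + (c - e - (i - b)) + (i - d - (a - e)) = 0.
Proof.
rewrite !opprB !addrA.
by rewrite (ACl (1*12*(7*2)*(3*10)*(5*4)*(11*6)*(9*8)))%AC /= !subrr !addr0.
Qed.

Section EndLie.
Variables (K : fieldType) (V : vectType K).
Implicit Types f g h : 'End(V).

Definition end_lie f g : 'End(V) := ((f \o g) - (g \o f))%VF.

Fact end_lie_linearl a f g h :
  end_lie (a *: f + g) h = a *: end_lie f h + end_lie g h.
Proof.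
rewrite /end_lie comp_lfunDl comp_lfunDr -comp_lfunZl -comp_lfunZr.
by rewrite scalerBr opprD addrACA.
Qed.

Fact end_lie_linearr h a f g :
  end_lie h (a *: f + g) = a *: end_lie h f + end_lie h g.
Proof.
rewrite /end_lie comp_lfunDl comp_lfunDr -comp_lfunZl -comp_lfunZr.
by rewrite scalerBr opprD addrACA.
Qed.

Fact end_liexx f : end_lie f f = 0. Proof. by rewrite /end_lie subrr. Qed.

Fact end_lie_jacobi f g h :
  end_lie f (end_lie g h) + end_lie g (end_lie h f)
    + end_lie h (end_lie f g) = 0.
Proof.
rewrite /end_lie !(comp_lfunDl, comp_lfunDr, comp_lfunNl, comp_lfunNr).
by rewrite !comp_lfunA; apply: jacobi_cancel.
Qed.

HB.instance Definition _ := Vector_isLie.Build K 'End(V)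
  end_lie_linearl end_lie_linearr end_liexx end_lie_jacobi.

End EndLie.

Section MatrixLie.
Variables (K : fieldType) (n : nat).
Implicit Types A B C : 'M[K]_n.

Definition mx_lie A B : 'M[K]_n := A *m B - B *m A.

Fact mx_lie_linearl a A B C :
  mx_lie (a *: A + B) C = a *: mx_lie A C + mx_lie B C.
Proof.
rewrite /mx_lie mulmxDl mulmxDr -scalemxAl -scalemxAr.
by rewrite scalerBr opprD addrACA.
Qed.

Fact mx_lie_linearr C a A B :
  mx_lie C (a *: A + B) = a *: mx_lie C A + mx_lie C B.
Proof.
rewrite /mx_lie mulmxDl mulmxDr -scalemxAl -scalemxAr.
by rewrite scalerBr opprD addrACA.
Qed.

Fact mx_liexx A : mx_lie A A = 0. Proof. by rewrite /mx_lie subrr. Qed.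

Fact mx_lie_jacobi A B C :
  mx_lie A (mx_lie B C) + mx_lie B (mx_lie C A) + mx_lie C (mx_lie A B) = 0.
Proof.
rewrite /mx_lie !(mulmxBl, mulmxBr) !mulmxA; exact: jacobi_cancel.
Qed.

HB.instance Definition _ := Vector_isLie.Build K 'M[K]_n
  mx_lie_linearl mx_lie_linearr mx_liexx mx_lie_jacobi.

Fact so_subspace : is_subspace (fun A : 'M[K]_n => A^T = - A).
Proof.
split=> [|a A B hA hB]; first by rewrite trmx0 oppr0.
by rewrite linearP /= hA hB scalerN opprD.
Qed.

Definition so : {vspace 'M[K]_n} := vspace_of so_subspace.

End MatrixLie.

Arguments so K n : clear implicits.

Section ComplexMatrixLie.
Variables (R : rcfType) (n : nat).

(* The alias carries the structure of a REAL Lie algebra: [a *: A] is defined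
   for [a : R] only. *)
Definition complex_mx (R : rcfType) (n : nat) : Type := 'M[R[i]]_n.
Local Notation M := (complex_mx R n).

HB.instance Definition _ := GRing.Zmodule.copy M 'M[R[i]]_n.

Implicit Types A B C : M.

Definition complex_mx_scale (a : R) A : M :=
  (a%:C)%C *: (A : 'M[R[i]]_n).

Fact complex_mx_scaleA a b A :
  complex_mx_scale a (complex_mx_scale b A) = complex_mx_scale (a * b) A.
Proof. by rewrite /complex_mx_scale scalerA rmorphM. Qed.

Fact complex_mx_scale1 : left_id 1 complex_mx_scale.
Proof. by move=> A; rewrite /complex_mx_scale rmorph1 scale1r. Qed.

Fact complex_mx_scaleDr : right_distributive complex_mx_scale +%R.
Proof. by move=> a A B; rewrite /complex_mx_scale scalerDr. Qed.

Fact complex_mx_scaleDl A : {morph complex_mx_scale^~ A : a b / a + b}.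
Proof. by move=> a b; rewrite /complex_mx_scale rmorphD scalerDl. Qed.

HB.instance Definition _ := GRing.Zmodule_isLmodule.Build R M
  complex_mx_scaleA complex_mx_scale1 complex_mx_scaleDr complex_mx_scaleDl.

Lemma complex_mx_scaleE a A : a *: A = (a%:C)%C *: (A : 'M[R[i]]_n) :> M.
Proof. by []. Qed.

Definition complex_mx_v2r A : 'rV[R]_(n * n + n * n) :=
  row_mx (mxvec (\matrix_(i, j) Re (A i j))) (mxvec (\matrix_(i, j) Im (A i j))).

Definition complex_mx_r2v (v : 'rV[R]_(n * n + n * n)) : M :=
  \matrix_(i, j) Complex (vec_mx (lsubmx v) i j) (vec_mx (rsubmx v) i j).

Fact complex_mx_vect : Vector.axiom (n * n + n * n) M.
Proof.
exists complex_mx_v2r.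
  move=> a A B; rewrite /complex_mx_v2r scale_row_mx add_row_mx.
  congr row_mx; rewrite -linearP /=; congr mxvec; apply/matrixP=> i j;
    rewrite complex_mx_scaleE !mxE; case: (A i j) (B i j) => [x y] [x' y'] /=;
    by rewrite ?mul0r ?subr0 ?addr0.
exists complex_mx_r2v=> [A | v].
  apply/matrixP=> i j; rewrite /complex_mx_v2r mxE row_mxKl row_mxKr !mxvecK.
  by rewrite !mxE; case: (A i j).
rewrite /complex_mx_v2r -[RHS]hsubmxK; congr row_mx.
  by rewrite -[RHS]vec_mxK; congr mxvec; apply/matrixP=> i j; rewrite !mxE.
by rewrite -[RHS]vec_mxK; congr mxvec; apply/matrixP=> i j; rewrite !mxE.
Qed.

HB.instance Definition _ := Lmodule_hasFinDim.Build R M complex_mx_vect.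

Definition complex_mx_lie A B : M :=
  (A : 'M[R[i]]_n) *m B - (B : 'M[R[i]]_n) *m A.

Fact complex_mx_lie_linearl a A B C :
  complex_mx_lie (a *: A + B) C =
    a *: complex_mx_lie A C + complex_mx_lie B C.
Proof. exact: (@mx_lie_linearl R[i]). Qed.

Fact complex_mx_lie_linearr C a A B :
  complex_mx_lie C (a *: A + B) =
    a *: complex_mx_lie C A + complex_mx_lie C B.
Proof. exact: (@mx_lie_linearr R[i]). Qed.

Fact complex_mx_liexx A : complex_mx_lie A A = 0.
Proof. exact: (@mx_liexx R[i]). Qed.

Fact complex_mx_lie_jacobi A B C :
  complex_mx_lie A (complex_mx_lie B C) + complex_mx_lie B (complex_mx_lie C A)
    + complex_mx_lie C (complex_mx_lie A B) = 0.
Proof. exact: (@mx_lie_jacobi R[i]). Qed.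

HB.instance Definition _ := Vector_isLie.Build R M
  complex_mx_lie_linearl complex_mx_lie_linearr
  complex_mx_liexx complex_mx_lie_jacobi.

Definition is_su (A : M) := (map_mx conjc A)^T = - A /\ \tr A = 0.

Fact su_subspace : is_subspace is_su.
Proof.
split=> [|a A B [hA tA] [hB tB]]; first by split; rewrite ?map_mx0 ?trmx0 ?oppr0 ?mxtrace0.
split; rewrite complex_mx_scaleE.
  rewrite map_mxD map_mxZ linearD linearZ /= hA hB.
  by rewrite oppr0 opprD scalerN.
by rewrite mxtraceD mxtraceZ tA tB mulr0 addr0.
Qed.

Definition su : {vspace M} := vspace_of su_subspace.

End ComplexMatrixLie.

Arguments su R n : clear implicits.

Section Oscillator.
Variables (R : realType) (m : nat).

(* The triple (a, v, c) is a delta + v + c z, the coordinates of v being taken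
   in the ordered basis x_1, ..., x_m, y_1, ..., y_m; see the basis elements
   and the bracket table below. *)
Definition oscillator (R : realType) (m : nat) : Type :=
  (R^o * 'cV[R]_(m + m) * R^o)%type.
Local Notation d := (oscillator R m).

HB.instance Definition _ := Vector.copy d (R^o * 'cV[R]_(m + m) * R^o)%type.

Definition osc (a : R) (v : 'cV[R]_(m + m)) (c : R) : d := (a, v, c).
Definition dcoord (u : d) : R := u.1.1.
Definition vcoord (u : d) : 'cV[R]_(m + m) := u.1.2.
Definition zcoord (u : d) : R := u.2.

Definition osc_delta : d := osc 1 0 0.
Definition osc_x (i : 'I_m) : d := osc 0 (delta_mx (lshift m i) 0) 0.
Definition osc_y (i : 'I_m) : d := osc 0 (delta_mx (rshift m i) 0) 0.
Definition osc_z : d := osc 0 0 1.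

(* v |-> [delta, v] and the coefficient of z in [v, w], for v and w in V. *)
Definition osc_rot (v : 'cV[R]_(m + m)) : 'cV[R]_(m + m) :=
  col_mx (- dsubmx v) (usubmx v).
Definition osc_symp (v w : 'cV[R]_(m + m)) : R :=
  \sum_(i < m) (v (lshift m i) 0 * w (rshift m i) 0
                - v (rshift m i) 0 * w (lshift m i) 0).

Definition osc_lie (u w : d) : d :=
  osc 0 (dcoord u *: osc_rot (vcoord w) - dcoord w *: osc_rot (vcoord u))
      (osc_symp (vcoord u) (vcoord w)).

Lemma osc_eq (u w : d) :
  dcoord u = dcoord w -> vcoord u = vcoord w -> zcoord u = zcoord w -> u = w.
Proof.
case: u => -[a v] c; case: w => -[a' v'] c'.
by rewrite /dcoord /vcoord /zcoord /= => -> -> ->.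
Qed.

Lemma dcoordP b (u w : d) : dcoord (b *: u + w) = b * dcoord u + dcoord w.
Proof. by []. Qed.
Lemma vcoordP b (u w : d) : vcoord (b *: u + w) = b *: vcoord u + vcoord w.
Proof. by []. Qed.
Lemma zcoordP b (u w : d) : zcoord (b *: u + w) = b * zcoord u + zcoord w.
Proof. by []. Qed.

Fact osc_rot_linear : linear osc_rot.
Proof.
move=> b v w; rewrite /osc_rot !linearP /= scale_col_mx.
by rewrite add_col_mx.
Qed.
HB.instance Definition _ :=
  GRing.isLinear.Build R 'cV[R]_(m + m) 'cV[R]_(m + m) *:%R osc_rot
    osc_rot_linear.

Lemma osc_rotEl v i : osc_rot v (lshift m i) 0 = - v (rshift m i) 0.
Proof. by rewrite col_mxEu !mxE. Qed.

Lemma osc_rotEr v i : osc_rot v (rshift m i) 0 = v (lshift m i) 0.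
Proof. by rewrite col_mxEd !mxE. Qed.

Lemma osc_sympC v w : osc_symp v w = - osc_symp w v.
Proof.
rewrite /osc_symp -sumrN; apply: eq_bigr => i _; ring.
Qed.

Lemma osc_sympPr v b w w' :
  osc_symp v (b *: w + w') = b * osc_symp v w + osc_symp v w'.
Proof.
rewrite /osc_symp mulr_sumr -big_split; apply: eq_bigr => i _ /=.
rewrite !mxE; ring.
Qed.

Lemma osc_sympPl v b w w' :
  osc_symp (b *: w + w') v = b * osc_symp w v + osc_symp w' v.
Proof. by rewrite osc_sympC osc_sympPr !(osc_sympC v) opprD mulrN !opprK. Qed.

Lemma osc_symp_rot v w : osc_symp v (osc_rot w) = osc_symp w (osc_rot v).
Proof.
rewrite /osc_symp; apply: eq_bigr => i _.
by rewrite /osc_rot !(col_mxEu, col_mxEd) !mxE; ring.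
Qed.

Fact osc_lie_linearl b u w t :
  osc_lie (b *: u + w) t = b *: osc_lie u t + osc_lie w t.
Proof.
apply: osc_eq; rewrite ?dcoordP ?vcoordP ?zcoordP /=.
- by rewrite mulr0 addr0.
- rewrite /vcoord /= -!/(vcoord _) -!/(dcoord _) linearP /= scalerBr scalerDl scalerDr !scalerA.
  by rewrite opprD addrACA (mulrC b (dcoord t)).
- exact: osc_sympPl.
Qed.

Fact osc_liexx u : osc_lie u u = 0.
Proof.
apply: osc_eq => //=; first by rewrite /vcoord /= subrr.
by rewrite /zcoord /= /osc_symp big1 // => i _; ring.
Qed.

Fact osc_lieC u w : osc_lie u w = - osc_lie w u.
Proof.
apply: osc_eq; first by rewrite /dcoord /= oppr0.
  by rewrite /vcoord /= opprB.
by rewrite /zcoord /= osc_sympC.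
Qed.

Fact osc_lie_linearr t b u w :
  osc_lie t (b *: u + w) = b *: osc_lie t u + osc_lie t w.
Proof. by rewrite osc_lieC osc_lie_linearl opprD -scalerN -!osc_lieC. Qed.

Fact osc_lie_jacobi u w t :
  osc_lie u (osc_lie w t) + osc_lie w (osc_lie t u) + osc_lie t (osc_lie u w)
    = 0.
Proof.
have sub0 (v : 'cV[R]_(m + m)) : (0 : R) *: v = 0 by rewrite scale0r.
apply: osc_eq.
- by rewrite /dcoord /= !addr0.
- rewrite /vcoord /= -!/(dcoord _) -!/(vcoord _) !sub0 !subr0 !linearB /=.
  rewrite !linearZ /= !scalerN !addrA.
  by rewrite (ACl ((1*4)*(6*3)*(2*5)))%AC /= !(addrN, addNr) !addr0.
- have sym0 v : osc_symp v 0 = 0.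
    by rewrite /osc_symp big1 // => i _; rewrite !mxE; ring.
  have symN v x : osc_symp v (- x) = - osc_symp v x.
    by rewrite -[- x]addr0 -scaleN1r osc_sympPr sym0 addr0 mulN1r.
  have symB v (a b : R) x y : osc_symp v (a *: osc_rot x - b *: osc_rot y)
      = a * osc_symp v (osc_rot x) - b * osc_symp v (osc_rot y).
    by rewrite osc_sympPr -scalerN -[_ *: - _]addr0 osc_sympPr symN sym0 addr0 mulrN.
  rewrite /zcoord /= !symB -!/(dcoord _) -!/(vcoord _).
  rewrite (osc_symp_rot (vcoord t) (vcoord u)).
  rewrite (osc_symp_rot (vcoord t) (vcoord w)).
  rewrite (osc_symp_rot (vcoord w) (vcoord u)).
  ring.
Qed.

HB.instance Definition _ := Vector_isLie.Build R d
  osc_lie_linearl osc_lie_linearr osc_liexx osc_lie_jacobi.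

Lemma lie_delta_x i : lie osc_delta (osc_x i) = osc_y i.
Proof.
apply: osc_eq => //; last by rewrite /zcoord /= /osc_symp big1 // => k _; rewrite !mxE; ring.
rewrite /vcoord /= /dcoord /= scale1r scale0r subr0 /osc_rot.
apply/matrixP=> k l; case: (split_ordP k) => k' ->;
  rewrite !(col_mxEu, col_mxEd) !mxE.
  by rewrite !(eq_lrshift, eq_rlshift) oppr0.
by rewrite eq_lshift eq_rshift.
Qed.

Lemma lie_delta_y i : lie osc_delta (osc_y i) = - osc_x i.
Proof.
apply: osc_eq; first by rewrite /dcoord /= oppr0.
- rewrite /vcoord /= /dcoord /= scale1r scale0r subr0 /osc_rot.
  apply/matrixP=> k l; case: (split_ordP k) => k' ->;
    rewrite !(col_mxEu, col_mxEd) !mxE.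
    by rewrite eq_lshift eq_rshift.
  by rewrite !(eq_lrshift, eq_rlshift) oppr0.
- rewrite /zcoord /= /osc_symp big1 ?oppr0 // => k _; rewrite !mxE; ring.
Qed.

Lemma lie_x_y i j : lie (osc_x i) (osc_y j) = if i == j then osc_z else 0.
Proof.
apply: osc_eq; first by case: eqP.
  by rewrite /vcoord /= /dcoord /= !scale0r subr0; case: eqP.
rewrite /zcoord /= /osc_symp (bigD1 i) //= big1 ?addr0 => [|k ki];
  rewrite !mxE ?eqxx ?eq_lshift ?eq_rshift ?(eq_lrshift, eq_rlshift) /=.
  by case: eqP => _ /=; rewrite /zcoord /=; ring.
by rewrite (negbTE ki) /=; ring.
Qed.

Lemma lie_x_x i j : lie (osc_x i) (osc_x j) = 0.
Proof.
apply: osc_eq => //; first by rewrite /vcoord /= /dcoord /= !scale0r subr0.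
rewrite /zcoord /= /osc_symp big1 // => k _.
rewrite !mxE !(eq_lrshift, eq_rlshift) /=; ring.
Qed.

Lemma lie_y_y i j : lie (osc_y i) (osc_y j) = 0.
Proof.
apply: osc_eq => //; first by rewrite /vcoord /= /dcoord /= !scale0r subr0.
rewrite /zcoord /= /osc_symp big1 // => k _.
rewrite !mxE !(eq_lrshift, eq_rlshift) /=; ring.
Qed.

Lemma lie_z u : lie osc_z u = 0.
Proof.
apply: osc_eq => //.
  by rewrite /vcoord /= /dcoord /= scale0r linear0 scaler0 subr0.
rewrite /zcoord /= /osc_symp big1 // => k _; rewrite !mxE; ring.
Qed.

Lemma osc_coordE u :
  u = dcoord u *: osc_delta
      + \sum_i (vcoord u (lshift m i) 0 *: osc_x i
                + vcoord u (rshift m i) 0 *: osc_y i)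
      + zcoord u *: osc_z.
Proof.
pose inV v := osc 0 v 0.
have inVP b v v' : inV (b *: v + v') = b *: inV v + inV v'.
  apply: osc_eq; rewrite ?dcoordP ?vcoordP ?zcoordP //.
    by rewrite /dcoord /= mulr0 addr0.
  by rewrite /zcoord /= mulr0 addr0.
have inV0 : inV 0 = 0 by [].
have inVZ b v : inV (b *: v) = b *: inV v.
  by rewrite -[_ *: _ in LHS]addr0 inVP inV0 addr0.
have inVD v v' : inV (v + v') = inV v + inV v'.
  by rewrite -[v in LHS]scale1r inVP scale1r.
have -> : \sum_i (vcoord u (lshift m i) 0 *: osc_x i
    + vcoord u (rshift m i) 0 *: osc_y i) = inV (vcoord u).
  rewrite [vcoord u in RHS]matrix_sum_delta big_split_ord /= inVD big_split /=.
  rewrite !(big_morph inV inVD inV0).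
  by congr (_ + _); apply: eq_bigr => i _; rewrite big_ord1 inVZ.
apply: osc_eq.
- by rewrite /dcoord /= scaler0 !addr0 -[RHS]/(_ * 1) mulr1.
- by rewrite /vcoord /= !scaler0 add0r addr0.
- by rewrite /zcoord /= scaler0 !add0r -[RHS]/(_ * 1) mulr1.
Qed.

(* phi_{0,1} *)
Definition osc_form (u w : d) : R :=
  \sum_k vcoord u k 0 * vcoord w k 0
    + (dcoord u * zcoord w + zcoord u * dcoord w).

Lemma osc_formC u w : osc_form u w = osc_form w u.
Proof.
rewrite /osc_form; congr (_ + _); last by ring.
by apply: eq_bigr => k _; rewrite mulrC.
Qed.

Lemma osc_formPl b u w t :
  osc_form (b *: u + w) t = b * osc_form u t + osc_form w t.
Proof.
rewrite /osc_form dcoordP zcoordP vcoordP mulrDr addrACA mulr_sumr -big_split /=.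
by congr (_ + _); [apply: eq_bigr => k _; rewrite !mxE|]; ring.
Qed.

Lemma osc_formPr b u w t :
  osc_form t (b *: u + w) = b * osc_form t u + osc_form t w.
Proof. by rewrite osc_formC osc_formPl !(osc_formC t). Qed.

Lemma osc_form_invariant u w t :
  osc_form (lie u w) t = osc_form u (lie w t).
Proof.
rewrite /osc_form [zcoord _]/= [dcoord (lie _ _)]/= [vcoord (lie u w)]/= [vcoord (lie w t)]/=.
rewrite !big_split_ord /= /zcoord /= /osc_symp.
rewrite mul0r mulr0 add0r addr0 mulr_suml mulr_sumr -!big_split /=.
apply: eq_bigr => i _; rewrite /vcoord /= -!/(vcoord _).
have rowE (a b : R) (v v' : 'cV[R]_(m + m)) k :
  (a *: v - b *: v') k 0 = a * v k 0 - b * v' k 0 by rewrite !mxE.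
rewrite !rowE !osc_rotEl !osc_rotEr; ring.
Qed.

Definition is_skew_derivation (f : 'End(d)) :=
  is_derivation f /\
  forall u w, osc_form (f u) w + osc_form u (f w) = 0.

Fact skew_derivation_subspace : is_subspace is_skew_derivation.
Proof.
have [D0 DL] := @is_derivation_subspace R d.
split=> [|b f g [Df sf] [Dg sg]]; split; [by [] | | exact: DL |] => u w.
  have form0 t : osc_form 0 t = 0.
    by have := osc_formPl (-1) 0 0 t; rewrite scaler0 addr0 mulN1r addNr.
  by rewrite !zero_lfunE (osc_formC u) !form0 addr0.
rewrite !add_lfunE !scale_lfunE osc_formPl osc_formPr addrACA -mulrDr sf sg.
by rewrite mulr0 addr0.
Qed.

Definition Der_form : {vspace 'End(d)} := vspace_of skew_derivation_subspace.

Definition D012_fun (u : d) : d := osc 0 (vcoord u) (2 * zcoord u).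
Definition D100_fun (u : d) : d := osc 0 0 (dcoord u).
Definition V_act_fun (A : 'M[R]_(m + m)) (u : d) : d :=
  osc 0 (A *m vcoord u) 0.

Fact D012_fun_linear : linear D012_fun.
Proof.
move=> b u w; apply: osc_eq; [| by [] |].
  by rewrite dcoordP /dcoord /=; ring.
have Ez t : zcoord (D012_fun t) = 2 * zcoord t by [].
by rewrite zcoordP !Ez zcoordP; ring.
Qed.
HB.instance Definition _ :=
  GRing.isLinear.Build R d d *:%R D012_fun D012_fun_linear.

Fact D100_fun_linear : linear D100_fun.
Proof.
move=> b u w; apply: osc_eq; rewrite ?dcoordP ?vcoordP ?zcoordP //.
  by rewrite /dcoord /=; ring.
by rewrite /vcoord /= scaler0 addr0.
Qed.
HB.instance Definition _ :=
  GRing.isLinear.Build R d d *:%R D100_fun D100_fun_linear.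

Fact V_act_fun_linear A : linear (V_act_fun A).
Proof.
move=> b u w; apply: osc_eq; rewrite ?dcoordP ?vcoordP ?zcoordP //.
- by rewrite /dcoord /=; ring.
- by rewrite /vcoord /= mulmxDr -scalemxAr.
- by rewrite /zcoord /=; ring.
Qed.
HB.instance Definition _ A :=
  GRing.isLinear.Build R d d *:%R (V_act_fun A) (V_act_fun_linear A).

(* D012 and D100 are the derivations D_{0,1,2} and D_{1,0,0}. *)
Definition D012 : 'End(d) := linfun D012_fun.
Definition D100 : 'End(d) := linfun D100_fun.

(* A square matrix of size 2m acting on V and killing delta and z. *)
Definition V_act A : 'End(d) := linfun (V_act_fun A).

Lemma D012_delta : D012 osc_delta = 0.
Proof.
by rewrite lfunE; apply: osc_eq; rewrite // /zcoord /= mulr0.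
Qed.

Lemma D012_V v : D012 (osc 0 v 0) = osc 0 v 0.
Proof. by rewrite lfunE; apply: osc_eq; rewrite // /zcoord /= mulr0. Qed.

Lemma D012_z : D012 osc_z = 2 *: osc_z.
Proof.
rewrite lfunE; apply: osc_eq => //; first by rewrite /dcoord /= scaler0.
by rewrite /vcoord /= scaler0.
Qed.

Lemma D100_delta : D100 osc_delta = osc_z.
Proof. by rewrite lfunE. Qed.

Lemma D100_lie u w : D100 (lie u w) = 0.
Proof. by rewrite lfunE. Qed.

Lemma V_act_coord A a v c : V_act A (osc a v c) = osc 0 (A *m v) 0.
Proof. by rewrite lfunE. Qed.

Lemma V_actP b A B : V_act (b *: A + B) = b *: V_act A + V_act B.
Proof.
apply/lfunP=> u; rewrite add_lfunE scale_lfunE !lfunE; apply: osc_eq.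
- by rewrite /dcoord /= scaler0 addr0.
- by rewrite /vcoord /= mulmxDl -scalemxAl.
- by rewrite /zcoord /= scaler0 addr0.
Qed.

Definition s_elt (f : 'End(d)) :=
  exists M P : 'M[R]_m,
    [/\ M^T = - M, P^T = P & f = V_act (block_mx M P (- P) M)].

Fact s_subspace : is_subspace s_elt.
Proof.
split.
  exists 0, 0; split; rewrite ?trmx0 ?oppr0 //.
  apply/lfunP=> u; rewrite zero_lfunE lfunE block_mx0; apply: osc_eq => //.
  by rewrite /vcoord /= mul0mx.
move=> b _ _ [M [P [hM hP ->]]] [M' [P' [hM' hP' ->]]].
exists (b *: M + M'), (b *: P + P'); split.
- by rewrite linearP /= hM hM' scalerN opprD.
- by rewrite linearP /= hP hP'.
- by rewrite -V_actP scale_block_mx add_block_mx scalerN opprD.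
Qed.

Definition s_lie : {vspace 'End(d)} := vspace_of s_subspace.

Definition s0_elt (f : 'End(d)) :=
  exists M : 'M[R]_m, M^T = - M /\ f = V_act (block_mx M 0 0 M).

Fact s0_subspace : is_subspace s0_elt.
Proof.
split.
  exists 0; split; rewrite ?trmx0 ?oppr0 //.
  apply/lfunP=> u; rewrite zero_lfunE lfunE block_mx0; apply: osc_eq => //.
  by rewrite /vcoord /= mul0mx.
move=> b _ _ [M [hM ->]] [M' [hM' ->]].
exists (b *: M + M'); split; first by rewrite linearP /= hM hM' scalerN opprD.
by rewrite -V_actP scale_block_mx add_block_mx scaler0 addr0.
Qed.

Definition s0_lie : {vspace 'End(d)} := vspace_of s0_subspace.

End Oscillator.

Arguments D012 R m : clear implicits.
Arguments D100 R m : clear implicits.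
Arguments Der_form R m : clear implicits.
Arguments s_lie R m : clear implicits.
Arguments s0_lie R m : clear implicits.

(* Main.v *)
From HB Require Import structures.
Require Import Defs.
From mathcomp Require Import all_boot all_order all_algebra.
From mathcomp Require Import complex ring.
From mathcomp Require Import boolp reals.

Set Implicit Arguments.
Unset Strict Implicit.
Unset Printing Implicit Defensive.

Import GRing.Theory Num.Theory.
Local Open Scope ring_scope.
Local Open Scope complex_scope.

(** Write a vector of the oscillator algebra as a delta + v + c z, and let J be
    the matrix of multiplication by i on V = R^m + i R^m = C^m.  Then
    [delta, v] = J v and [v, w] = (J v . w) z, so the bracket is governed by the
    complex structure J and the euclidean product.

    Derivations.  A derivation D preserves the centre R z, and it maps
    V = [delta, V] into V + R z; let A be the matrix of the V-component of D on V,
    let D z = mu z, and let a be the delta-component of D delta.  Applying D to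
    [delta, v] gives A J - J A = a J, and taking the trace after multiplication by
    J forces a = 0; applying D to [v, w] then gives A + A^T = mu.  Hence A - mu / 2
    is a skew matrix commuting with J, which is an element of s; once it and
    (mu / 2) D_{0,1,2} are subtracted from D, there remains an inner derivation plus
    a multiple of D_{1,0,0}.  This is [derivation_decomp]; evaluating such a
    decomposition at delta, at z and on V shows that it is direct
    ([Der_oscillator_indep]), and that skewness with respect to the form kills the
    coefficients of D_{1,0,0} and D_{0,1,2} ([Der_form_oscillator]).

    The algebra s.  Realification of complex matrices, followed by the action on V,
    is an injective Lie morphism [cact], and it maps the skew-Hermitian matrices
    u(m) onto s.  There i goes to J, that is to ad delta, so s is spanned modulo
    Inner by the image of su(m).  As su(m) is simple it is perfect, whence
    [u(m), u(m)] = su(m) and [s, s] is the image of su(m); for m = 1 this image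
    vanishes, which gives the last part of the theorem.

    Simplicity.  For su(m), an ideal I generates the complex ideal I + i I of
    sl(m, C) ([complexified_ideal]).  In sl(m) one has
    [E_ji, [E_ji, A]] = -2 A_ij E_ji, so a nonzero ideal contains an elementary
    matrix and then everything ([sl_ideal_full]); taking skew-Hermitian parts comes
    back to I.  For so(m), put L_pq = E_pq - E_qp: the operator - (ad L_pq)^2 is the
    projection onto the entries having exactly one index in {p, q}
    ([rotmx_lie2]).  Products of such projections isolate a single pair of entries
    when m = 3 or m >= 5, so a nonzero ideal contains some L_pq and then everything.
    (When m = 4 the projections cannot separate the pair {p, q} from its
    complement, in accordance with so(4) being a sum of two ideals.) *)

(** * Lie algebra generalities *)
Section LieGeneralities.
Variables (K : fieldType) (L L' : lieType K).
Implicit Types (x y : L) (U V W : {vspace L}).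

Lemma lieNr x y : lie x (- y) = - lie x y.
Proof. exact: linearN. Qed.

Lemma lie_prodS U U' V V' :
  (U <= U')%VS -> (V <= V')%VS -> (lie_prod U V <= lie_prod U' V')%VS.
Proof.
move=> /subvP sU /subvP sV; apply/lie_prodP=> x y Ux Vy.
by rewrite mem_lie_prod ?sU ?sV.
Qed.

Lemma adE x y : ad x y = lie x y.
Proof. by rewrite lfunE. Qed.

Lemma adD x y : ad (x + y) = ad x + ad y.
Proof. by apply/lfunP=> t; rewrite add_lfunE !adE lieDl. Qed.

Lemma adZ a x : ad (a *: x) = a *: ad x.
Proof. by apply/lfunP=> t; rewrite scale_lfunE !adE lieZl. Qed.

Lemma ad0 : ad (0 : L) = 0.
Proof. by apply/lfunP=> y; rewrite adE lie0l zero_lfunE. Qed.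

Lemma lie_lieE x y z : lie (lie x y) z = lie x (lie y z) - lie y (lie x z).
Proof.
rewrite (lieC (lie x y)); have /eqP := lie_jacobi x y z.
by rewrite addr_eq0 => /eqP <-; rewrite (lieC z x) lieNr.
Qed.

Lemma ad_lie x y : lie (ad x : 'End(L)) (ad y) = ad (lie x y).
Proof.
apply/lfunP=> z; rewrite /lie /= /end_lie add_lfunE opp_lfunE !comp_lfunE !adE.
by rewrite lie_lieE.
Qed.

Lemma mem_Inner x : ad x \in Inner L.
Proof. by apply/mem_vspace_of; exists x. Qed.

Lemma mem_Der f : f \in Der L <-> is_derivation f.
Proof. exact: mem_vspace_of. Qed.

Lemma Inner_sub_Der : (Inner L <= Der L)%VS.
Proof.
apply/subvP=> _ /mem_vspace_of[t ->]; apply/mem_vspace_of=> x y.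
by rewrite !adE lie_lieE subrK.
Qed.

Lemma limg_lie_prod (f : 'Hom(L, L')) U V :
    {in U & V, forall x y, f (lie x y) = lie (f x) (f y)} ->
  (f @: lie_prod U V)%VS = lie_prod (f @: U) (f @: V).
Proof.
move=> fM; apply/eqP; rewrite eqEsubv; apply/andP; split.
  have /subvP sub : (lie_prod U V <= f @^-1: lie_prod (f @: U) (f @: V))%VS.
    apply/lie_prodP=> x y Ux Vy; rewrite -memv_preim fM //.
    by rewrite mem_lie_prod ?memv_img.
  by apply/subvP=> _ /memv_imgP[u Uu ->]; rewrite memv_preim sub.
apply/lie_prodP=> _ _ /memv_imgP[x Ux ->] /memv_imgP[y Vy ->].
by rewrite -fM // memv_img // mem_lie_prod.
Qed.

(** The isomorphism is the left inverse of [f], which is linear on the whole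
    ambient space, as [lie_isomorphic] asks. *)
Lemma limg_isomorphic (f : 'Hom(L', L)) (W : {vspace L'}) :
    injective f -> {in W &, forall x y : L', f (lie x y) = lie (f x) (f y)} ->
  lie_subalg W -> lie_isomorphic (f @: W) W.
Proof.
move=> fI fM Wsub; have fK : cancel f f^-1%VF.
  by apply/lker0_lfunK/lker0P.
split=> //.
  apply/lie_prodP=> _ _ /memv_imgP[x Wx ->] /memv_imgP[y Wy ->].
  by rewrite -fM // memv_img // (lie_prodP _ _ _ Wsub).
exists f^-1%VF; split.
- move=> _ _ /memv_imgP[x _ ->] /memv_imgP[y _ ->].
  by rewrite !fK => ->.
- by rewrite -limg_comp lker0_compVf ?lim1g //; apply/lker0P.
- move=> _ _ /memv_imgP[x Wx ->] /memv_imgP[y Wy ->].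
  by rewrite -fM // !fK.
Qed.

End LieGeneralities.

(** * Simplicity of so(m) for m = 3 and m >= 5 *)
Section SpecialOrthogonal.
Variables (K : fieldType) (m : nat).
Hypothesis K2 : 2 != 0 :> K.
Implicit Types (A : 'M[K]_m) (I : {vspace 'M[K]_m}) (p q : 'I_m).

Lemma mx_lieE n (A B : 'M[K]_n) : lie A B = A *m B - B *m A.
Proof. by []. Qed.

Lemma mem_so A : A \in so K m <-> A^T = - A.
Proof. exact: mem_vspace_of. Qed.

Lemma so_entryC A : A \in so K m -> forall i j, A i j = - A j i.
Proof. by move=> /mem_so hA i j; rewrite -[A in LHS]trmxK hA !mxE. Qed.

Lemma so_diag A : A \in so K m -> forall i, A i i = 0.
Proof.
move=> soA i; apply/eqP; have /eqP := so_entryC soA i i.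
by rewrite -addr_eq0 -mulr2n -mulr_natr mulf_eq0 (negbTE K2) orbF.
Qed.

Lemma so_subalg : lie_subalg (so K m).
Proof.
apply/lie_prodP=> A B /mem_so hA /mem_so hB; apply/mem_so.
by rewrite mx_lieE linearB /= !trmx_mul hA hB !mulNmx !mulmxN !opprK opprB.
Qed.

(** The infinitesimal rotation of the coordinate plane (p, q). *)
Definition rotmx p q : 'M[K]_m := delta_mx p q - delta_mx q p.

Lemma rotmxC p q : rotmx q p = - rotmx p q.
Proof. by rewrite /rotmx opprB. Qed.

Lemma rotmx_so p q : rotmx p q \in so K m.
Proof. by apply/mem_so; rewrite linearB /= !trmx_delta opprB. Qed.

Lemma rotmx_lie p q r :
  p != q -> q != r -> p != r -> lie (rotmx p q) (rotmx q r) = rotmx p r.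
Proof.
move=> pq qr pr; have qp := pq; have rq := qr; have rp := pr.
rewrite eq_sym in qp; rewrite eq_sym in rq; rewrite eq_sym in rp.
rewrite mx_lieE !mulmxBl !mulmxBr !mul_delta_mx_cond.
rewrite !eqxx (negbTE pq) (negbTE qr) (negbTE pr) (negbTE qp) (negbTE rq) (negbTE rp).
by rewrite !mulr0n !mulr1n !subr0 !sub0r opprK.
Qed.

Lemma so_sum_rotmx A :
  A \in so K m -> A = \sum_i \sum_j (2^-1 * A i j) *: rotmx i j.
Proof.
move=> soA.
under eq_bigr do under eq_bigr do rewrite scalerBr.
under eq_bigr do rewrite sumrB.
rewrite sumrB [X in _ - X]exchange_big /=.
rewrite -sumrB [LHS]matrix_sum_delta; apply: eq_bigr => i _.
rewrite -sumrB; apply: eq_bigr => j _.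
rewrite (so_entryC soA j i) mulrN scaleNr opprK -scalerDl -mulrDl.
have -> : 2^-1 + 2^-1 = 1 :> K by field.
by rewrite mul1r.
Qed.

Definition meets_once p q (i j : 'I_m) :=
  ((i == p) || (i == q)) (+) ((j == p) || (j == q)).

Definition mask_mx (e : rel 'I_m) A : 'M[K]_m :=
  \matrix_(i, j) (if e i j then A i j else 0).

(** [ad (rotmx p q)] rotates each pair of coordinates (p, k), (q, k) with k outside
    {p, q} by a quarter turn and kills the other coordinates of a skew matrix;
    hence its square is minus a coordinate projection. *)
Lemma rotmx_lie2 p q A : p != q -> A \in so K m ->
  lie (rotmx p q) (lie (rotmx p q) A) = - mask_mx (meets_once p q) A.
Proof.
move=> pq soA.
have rl B i j : (rotmx p q *m B) i j =
    (i == p)%:R * B q j - (i == q)%:R * B p j.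
  rewrite mulmxBl !mxE; congr (_ - _); [rewrite (bigD1 q) | rewrite (bigD1 p)] => //=;
  rewrite !mxE eqxx andbT big1 ?addr0 // => k /negbTE kq;
  by rewrite mxE kq andbF mul0r.
have rr B i j : (B *m rotmx p q) i j =
    B i p * (j == q)%:R - B i q * (j == p)%:R.
  rewrite mulmxBr !mxE; congr (_ - _); [rewrite (bigD1 p) | rewrite (bigD1 q)] => //=;
  rewrite !mxE eqxx big1 ?addr0 // => k /negbTE kq;
  by rewrite mxE kq mulr0.
apply/matrixP=> i j; rewrite !mx_lieE !(rl, rr, mxE) /meets_once.
rewrite ?eqxx ?(negbTE pq) ?[q == p]eq_sym ?(negbTE pq).
have App := so_diag soA p; have Aqq := so_diag soA q.
have Aqp := so_entryC soA q p.
case: (eqVneq i p) => [->|ip]; rewrite ?(negbTE pq) /=;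
  [|case: (eqVneq i q) => [->|iq] /=];
  (case: (eqVneq j p) => [->|jp]; rewrite ?(negbTE pq) /=;
  [|case: (eqVneq j q) => [->|jq] /=]); rewrite ?App ?Aqq ?Aqp; ring.
Qed.

(** The point of [rotmx_lie2]: an ideal is stable under every composite of these
    coordinate projections. *)
Lemma ideal_mask_mx I p (s : seq 'I_m) A :
    lie_ideal (so K m) I -> p \notin s -> A \in I ->
  mask_mx (fun i j => all (fun q => meets_once p q i j) s) A \in I.
Proof.
move=> [/subvP Iso Iid]; elim: s => [|q s IHs] /= ps IA.
  by congr (_ \in I): IA; apply/matrixP=> i j; rewrite mxE.
move: ps; rewrite inE negb_or => /andP[pq /IHs/(_ IA) IB].
set B := mask_mx _ _ in IB.
rewrite (_ : mask_mx _ A = mask_mx (meets_once p q) B).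
  rewrite -[mask_mx _ B]opprK memvN -(rotmx_lie2 pq (Iso _ IB)).
  have Ilie C : C \in I -> lie (rotmx p q) C \in I.
    by move=> IC; apply: (lie_prodP _ _ _ Iid) => //; apply: rotmx_so.
  by rewrite !Ilie.
by apply/matrixP=> i j; rewrite !mxE; case: (meets_once p q i j).
Qed.

Lemma mask_mx_single p q A : p != q -> A \in so K m ->
  mask_mx (fun i j => ((i == p) && (j == q)) || ((i == q) && (j == p))) A
    = A p q *: rotmx p q.
Proof.
move=> pq soA; apply/matrixP=> i j; rewrite !mxE.
case: (eqVneq i p) => [->|ip]; rewrite ?(negbTE pq) /=.
  case: (eqVneq j q) => [->|jq] /=; rewrite ?andbF ?andbT; ring.
case: (eqVneq i q) => [->|iq]; rewrite ?andbF /=; last by ring.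
case: (eqVneq j p) => [->|jp] /=; last by ring.
by rewrite (so_entryC soA q p); ring.
Qed.

(** The rotations are chained by [L_pq, L_qr] = L_pr: first all those whose plane
    contains the axis p are obtained, then all of them. *)
Lemma ideal_rotmx I p q : lie_ideal (so K m) I -> p != q ->
  rotmx p q \in I -> I = so K m.
Proof.
move=> [Iso Iid] pq Ipq; apply/eqP; rewrite eqEsubv Iso /=.
have sym r s : rotmx r s \in I -> rotmx s r \in I by rewrite rotmxC memvN.
have step r s t : rotmx r s \in I -> r != s -> r != t -> rotmx r t \in I.
  have [-> //|st Irs rs rt] := eqVneq s t.
  rewrite -(rotmx_lie rs st rt) lieC memvN.
  by apply: (lie_prodP _ _ _ Iid) => //; apply: rotmx_so.
have star k : k != p -> rotmx p k \in I.
  by move=> kp; apply: step Ipq pq _; rewrite eq_sym.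
have all k l : k != l -> rotmx k l \in I.
  have [->|kp] := eqVneq k p; first by rewrite eq_sym; apply: star.
  by move=> kl; apply: step (sym _ _ (star _ kp)) kp kl.
apply/subvP=> A /so_sum_rotmx->; apply: memv_suml => i _; apply: memv_suml => j _.
rewrite memvZ //; have [->|] := eqVneq i j; last exact: all.
by rewrite /rotmx subrr mem0v.
Qed.

(** With three indices, the pair {p, q} is the only one that meets both {r, p} and
    {r, q} in one point. *)
Lemma meets_once_all3 (p q r i j : 'I_m) :
    uniq [:: p; q; r] -> (forall k, k \in [:: p; q; r]) ->
  all (fun b => meets_once r b i j) [:: p; q]
    = ((i == p) && (j == q)) || ((i == q) && (j == p)).
Proof.
rewrite /= !inE !negb_or !andbT => /andP[/andP[pq pr] qr] full.
have := full i; have := full j; rewrite /meets_once !inE.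
have rp := pr; rewrite eq_sym in rp; have rq := qr; rewrite eq_sym in rq.
have qp := pq; rewrite eq_sym in qp.
by move=> /or3P[] /eqP-> /or3P[] /eqP->;
  rewrite ?eqxx ?(negbTE pq) ?(negbTE pr) ?(negbTE qr) ?(negbTE rp) ?(negbTE rq) ?(negbTE qp).
Qed.

(** A pair that contains p but meets each {p, b} only in p must be {p, q}; one that
    avoids p would have to contain every b outside {p, q}, and there are at least
    three of those when 5 <= m. *)
Lemma meets_once_all5 (p q i j : 'I_m) :
    (5 <= m)%N -> p != q ->
  all (fun b => meets_once p b i j) (enum [pred b | b \notin [:: p; q]])
    = ((i == p) && (j == q)) || ((i == q) && (j == p)).
Proof.
move=> m5 pq; set s := enum _.
have ms b : (b \in s) = (b \notin [:: p; q]) by rewrite mem_enum.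
(* This is where 5 <= m is used: four indices do not exhaust the range. *)
have [b sb bij] : exists2 b, b \in s & b \notin [:: i; j].
  have : (size [:: p; q; i; j] < #|'I_m|)%N by rewrite card_ord.
  case: (pickP [pred b | b \notin [:: p; q; i; j]]) => [b|all4].
    rewrite /= !inE !negb_or => /and4P[bp bq bi bj] _; exists b.
      by rewrite ms !inE negb_or bp.
    by rewrite !inE negb_or bi.
  rewrite ltnNge; case/negP; apply: leq_trans (card_size _).
  by apply/subset_leq_card/subsetP=> b _; have := all4 b; rewrite /= => /negbFE.
apply/allP/idP => [allij|].
  have := allij b sb; move: bij; rewrite ms in sb; move: sb.
  rewrite /meets_once !inE !negb_or => /andP[bp bq] /andP[bi bj].
  rewrite ![_ == b]eq_sym (negbTE bi) (negbTE bj) !orbF.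
  case: (eqVneq i p) => [Ei|ip]; case: (eqVneq j p) => [Ej|jp] //= _.
    rewrite andbF orbF; case: (eqVneq j q) => // jq.
    have := allij j; rewrite ms !inE negb_or jp jq => /(_ isT).
    by rewrite /meets_once Ei !eqxx orbT.
  rewrite andbT; case: (eqVneq i q) => // iq.
  have := allij i; rewrite ms !inE negb_or ip iq => /(_ isT).
  by rewrite /meets_once Ej !eqxx orbT.
case/orP=> /andP[/eqP-> /eqP->] c; rewrite ms !inE negb_or => /andP[cp cq];
  by rewrite /meets_once eqxx ?[q == p]eq_sym ?(negbTE pq) [q == c]eq_sym (negbTE cq).
Qed.

Lemma so_simple : (3 <= m)%N -> m <> 4%N -> lie_simple (so K m).
Proof.
move=> m3 m4; split; first exact: so_subalg.
  have lt_m k : (k <= 2)%N -> (k < m)%N by move=> k2; apply: leq_trans m3.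
  pose o k (hk : (k <= 2)%N) := Ordinal (lt_m k hk).
  pose a := o 0 isT; pose b := o 1 isT; pose c := o 2 isT.
  apply/negP=> /eqP so0; have : rotmx a c \in lie_prod (so K m) (so K m).
    by rewrite -(@rotmx_lie a b c) // mem_lie_prod // rotmx_so.
  rewrite so0 memv0 => /eqP/matrixP/(_ a c)/eqP.
  by rewrite !mxE !eqxx /= subr0 oner_eq0.
move=> I Iid; have [->|] := eqVneq I 0%VS; [by left | move=> I0; right].
move: (Iid) => [/subvP Iso _].
have A0 : vpick I != 0 by rewrite vpick0.
have IA := memv_pick I; set A := vpick I in IA A0.
have soA := Iso _ IA.
have [p [q Apq]] : exists p q, A p q != 0.
  apply: contrapT => noA; case/eqP: A0; apply/matrixP=> p q; rewrite mxE.
  by apply: contrapT => /eqP Apq; apply: noA; exists p, q.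
have pq : p != q by apply: contraNneq Apq => ->; rewrite (so_diag soA).
apply: (ideal_rotmx Iid pq); suff : A p q *: rotmx p q \in I.
  by move=> IL; rewrite -(scalerK Apq (rotmx p q)) memvZ.
rewrite -mask_mx_single //.
have [m5|m4'] := leqP 5 m.
  have := @ideal_mask_mx I p (enum [pred b | b \notin [:: p; q]]) A Iid _ IA.
  rewrite mem_enum !inE eqxx => /(_ isT); congr (_ \in I).
  by apply/matrixP=> i j; rewrite !mxE meets_once_all5.
have {m4'}m3' : m = 3.
  move: m4'; rewrite ltnS leq_eqVlt => /predU1P[//|m3'].
  by apply/eqP; rewrite eqn_leq m3 andbT.
have [r rpq] : exists r, r \notin [:: p; q].
  apply: contrapT => nor; have : (#|'I_m| <= size [:: p; q])%N.
    apply: leq_trans (card_size _); apply/subset_leq_card/subsetP=> b _.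
    by apply: contrapT => /negP bpq; apply: nor; exists b.
  by rewrite card_ord leqNgt m3.
have uniq3 : uniq [:: p; q; r].
  by move: rpq; rewrite /= !inE !negb_or pq andbT !(eq_sym r).
have full k : k \in [:: p; q; r].
  have : [:: p; q; r] =i 'I_m.
    apply/subset_cardP; last by apply/subsetP.
    by rewrite card_ord; apply: etrans (esym m3'); apply/card_uniqP.
  by move=> ->.
have := @ideal_mask_mx I r [:: p; q] A Iid rpq IA; congr (_ \in I).
by apply/matrixP=> i j; rewrite !mxE meets_once_all3.
Qed.

End SpecialOrthogonal.

(** * Ideals of sl(m) *)
Section SpecialLinear.
Variables (K : numFieldType) (m : nat).
Implicit Types (A T : 'M[K]_m) (i j k l : 'I_m).

Lemma delta_mx_sandwich (A : 'M[K]_m) i j k l :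
  delta_mx i j *m A *m delta_mx k l = A j k *: delta_mx i l.
Proof.
apply/matrixP=> r s; rewrite !mxE (bigD1 k) //= big1 => [|t /negbTE tk];
  last by rewrite !mxE tk mulr0.
rewrite !mxE (bigD1 j) //= big1 => [|t /negbTE tj]; last by rewrite !mxE tj andbF mul0r.
by rewrite !mxE !eqxx !addr0 andbT; case: eqP => _ /=; case: eqP => _ /=; ring.
Qed.

(** The terms in E_ji E_ji vanish since E_ji squares to zero; only the two
    sandwiches E_ji A E_ji = A_ij E_ji remain. *)
Lemma delta_mx_lie2 A i j : i != j ->
  mx_lie (delta_mx j i) (mx_lie (delta_mx j i) A)
    = - (2 * A i j) *: delta_mx j i.
Proof.
move=> ij; rewrite /mx_lie mulmxBl mulmxBr !mulmxA delta_mx_sandwich.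
rewrite -[_ *m delta_mx j i *m delta_mx j i]mulmxA mul_delta_mx_0 //.
by rewrite mul0mx mulmx0 sub0r subr0 -opprD -mulr2n scaleNr -scaler_nat scalerA.
Qed.

Lemma traceless_sum T o : \tr T = 0 ->
  T = \sum_i \sum_(j | j != i) T i j *: delta_mx i j
      + \sum_i T i i *: (delta_mx i i - delta_mx o o).
Proof.
move=> T0; under [X in _ + X]eq_bigr do rewrite scalerBr.
rewrite sumrB -scaler_suml (_ : \sum_i T i i = 0) // scale0r subr0.
rewrite -big_split [LHS]matrix_sum_delta; apply: eq_bigr => i _.
by rewrite (bigD1 i) //= addrC.
Qed.

Variable P : 'M[K]_m -> Prop.
Hypothesis Psub : is_subspace P.
Hypothesis Pideal : forall T A, \tr T = 0 -> P A -> P (mx_lie T A).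

Let PZ a A : P A -> P (a *: A).
Proof. by case: Psub => P0 PL PA; rewrite -[_ *: _]addr0; apply: PL. Qed.

Let PD A B : P A -> P B -> P (A + B).
Proof. by case: Psub => P0 PL PA PB; rewrite -[A]scale1r; apply: PL. Qed.

Let PZK a A : a != 0 -> P (a *: A) -> P A.
Proof. by move=> a0 /(PZ a^-1); rewrite scalerK. Qed.

Lemma mxtrace_delta i j : i != j -> \tr (delta_mx i j : 'M[K]_m) = 0.
Proof.
move=> ij; rewrite /mxtrace big1 // => k _.
by rewrite mxE; have [->|] := eqVneq k i; rewrite ?(negbTE ij).
Qed.

Lemma sl_ideal_flip A i j : P A -> i != j -> A i j != 0 -> P (delta_mx j i).
Proof.
move=> PA ij Aij; apply: (@PZK (- (2 * A i j))).
  by rewrite oppr_eq0 mulf_neq0 // pnatr_eq0.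
rewrite -delta_mx_lie2 //.
by apply: Pideal; last apply: Pideal; rewrite ?mxtrace_delta // eq_sym.
Qed.

(** Either some entry off the diagonal is nonzero, and [sl_ideal_flip] applies, or
    [A] is diagonal; its diagonal is then not constant because the trace vanishes
    in characteristic zero, and [E_ij, A] = (A_jj - A_ii) E_ij. *)
Lemma sl_ideal_delta A : P A -> A != 0 -> \tr A = 0 ->
  exists i j, i != j /\ P (delta_mx i j).
Proof.
move=> PA A0 trA.
have [[i [j [ij Aij]]]|noff] := pselect (exists i j, i != j /\ A i j != 0).
  by exists j, i; rewrite eq_sym; split=> //; apply: sl_ideal_flip PA ij Aij.
have off i j : i != j -> A i j = 0.
  by move=> ij; apply: contrapT => /eqP Aij; apply: noff; exists i, j.
have [i Aii] : exists i, A i i != 0.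
  apply: contrapT => nd; case/eqP: A0; apply/matrixP=> i j; rewrite mxE.
  have [<-|/off //] := eqVneq i j.
  by apply: contrapT => /eqP Aii; apply: nd; exists i.
have [j Aij] : exists j, A i i != A j j.
  apply: contrapT => nd; move: trA; rewrite /mxtrace (eq_bigr (fun=> A i i)).
    rewrite sumr_const card_ord => /eqP; rewrite mulrn_eq0 (negbTE Aii) orbF.
    by move=> /eqP m0; case: (i) => ?; rewrite m0.
  by move=> j _; apply: contrapT => /eqP; rewrite eq_sym => Aij; apply: nd; exists j.
have ij : i != j by apply: contraNneq Aij => ->.
exists i, j; split=> //; apply: (@PZK (A j j - A i i)).
  by rewrite subr_eq0 eq_sym.
have -> : (A j j - A i i) *: delta_mx i j = mx_lie (delta_mx i j) A.
  apply/matrixP=> k l; rewrite /mx_lie !mxE (bigD1 j) //= big1 => [|t tj]; last first.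
    by rewrite mxE (negbTE tj) andbF mul0r.
  rewrite (bigD1 i) //= big1 => [|t ti]; last by rewrite mxE (negbTE ti) mulr0.
  rewrite !mxE !eqxx andbT.
  have [->|ki] := eqVneq k i; have [->|lj] := eqVneq l j => /=.
  - ring.
  - by rewrite (off j l) 1?eq_sym //; ring.
  - by rewrite (off k i) //; ring.
  - ring.
by apply: Pideal; rewrite ?mxtrace_delta.
Qed.

(** Starting from one elementary matrix, [E_ij, E_jk] = E_ik changes the column
    and [sl_ideal_flip] transposes, which gives all E_kl with k <> l; the diagonal
    part is spanned by the E_kk - E_pp = [E_kp, E_pk]. *)
Lemma sl_ideal_full A : P A -> A != 0 -> \tr A = 0 ->
  forall T, \tr T = 0 -> P T.
Proof.
move=> PA A0 trA; have [p [q [pq Ppq]]] := sl_ideal_delta PA A0 trA.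
have flip i j : i != j -> P (delta_mx i j) -> P (delta_mx j i).
  by move=> ij Pij; apply: sl_ideal_flip Pij ij _; rewrite mxE !eqxx oner_eq0.
have tail i j k : i != j -> i != k -> P (delta_mx i j) -> P (delta_mx i k).
  move=> ij ik Pij; have [<- //|jk] := eqVneq j k.
  apply: (@PZK (-1)); first by rewrite oppr_eq0 oner_eq0.
  have -> : -1 *: delta_mx i k = mx_lie (delta_mx j k) (delta_mx i j) :> 'M[K]_m.
    rewrite /mx_lie mul_delta_mx_0 1?eq_sym // mul_delta_mx sub0r.
    by rewrite scaleN1r.
  by apply: Pideal; rewrite ?mxtrace_delta.
have all k l : k != l -> P (delta_mx k l).
  have Pp i : p != i -> P (delta_mx p i) by move=> pi; apply: tail Ppq.
  have [->|kp kl] := eqVneq k p; first exact: Pp.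
  by apply: (@tail k p) => //; rewrite eq_sym in kp; exact: (flip _ _ kp (Pp _ kp)).
have P0 : P 0 by case: Psub.
have Psum (I : finType) (Q : pred I) (F : I -> 'M[K]_m) :
    (forall x : I, Q x -> P (F x)) -> P (\sum_(x | Q x) F x).
  by move=> PF; apply: (big_ind P).
move=> T /(traceless_sum p)->; apply: PD; apply/Psum => i _.
  by apply/Psum => j ji; apply/PZ/all; rewrite eq_sym.
have [->|ip] := eqVneq i p; first by rewrite subrr scaler0.
apply: PZ; rewrite -(mul_delta_mx p i i) -(mul_delta_mx i p p).
by apply: Pideal; [apply: mxtrace_delta | apply: all; rewrite eq_sym].
Qed.

End SpecialLinear.

(** * Simplicity of su(m), by complexification *)
Section SpecialUnitary.
Variables (R : rcfType) (m : nat).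
Local Notation C := (R[i]).
Local Notation M := 'M[C]_m.
Implicit Types (A B X Y : M).

Definition hconj X : M := (map_mx conjc X)^T.

Lemma conjc_i : conjc ('i : C) = - 'i.
Proof. by apply/eqP; rewrite eq_complex /= oppr0 !eqxx. Qed.

Lemma hconjD X Y : hconj (X + Y) = hconj X + hconj Y.
Proof. by rewrite /hconj map_mxD linearD. Qed.

Lemma hconjN X : hconj (- X) = - hconj X.
Proof. by rewrite /hconj map_mxN linearN. Qed.

Lemma hconjZ (a : C) X : hconj (a *: X) = conjc a *: hconj X.
Proof. by rewrite /hconj map_mxZ linearZ. Qed.

Lemma hconjM X Y : hconj (X *m Y) = hconj Y *m hconj X.
Proof. by rewrite /hconj map_mxM trmx_mul. Qed.

Lemma hconjK : involutive hconj.
Proof. by move=> X; apply/matrixP=> i j; rewrite !mxE conjcK. Qed.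

Lemma mxtrace_hconj X : \tr (hconj X) = conjc (\tr X).
Proof.
rewrite /hconj mxtrace_tr /mxtrace rmorph_sum.
by apply: eq_bigr => i _; rewrite mxE.
Qed.

Lemma mem_su (X : complex_mx R m) : X \in su R m <-> hconj X = - (X : M) /\ \tr (X : M) = 0.
Proof. exact: mem_vspace_of. Qed.

Lemma skew_lie X Y : hconj X = - X -> hconj Y = - Y ->
  hconj (mx_lie X Y) = - mx_lie X Y /\ \tr (mx_lie X Y) = 0.
Proof.
move=> hX hY; split; last by rewrite linearB /= mxtrace_mulC subrr.
by rewrite /mx_lie hconjD hconjN !hconjM hX hY !mulNmx !mulmxN !opprK opprB.
Qed.

Lemma su_subalg : lie_subalg (su R m).
Proof.
by apply/lie_prodP=> X Y /mem_su[hX _] /mem_su[hY _]; apply/mem_su/skew_lie.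
Qed.

(** The complexification of su(m) is sl(m, C): [X] is the sum of its
    skew-Hermitian part (X - X^H) / 2 and of its Hermitian part (X + X^H) / 2, and the
    latter is i times a skew-Hermitian matrix. *)
Lemma traceless_su_decomp X : \tr X = 0 -> exists A B : complex_mx R m,
  [/\ A \in su R m, B \in su R m & X = (A : M) + 'i *: (B : M)].
Proof.
move=> trX; exists (2^-1 *: (X - hconj X) : M), ((- (2^-1 * 'i)) *: (X + hconj X) : M).
have h2 : conjc (2^-1 : C) = 2^-1 by rewrite fmorphV rmorph_nat.
have h2i : conjc (- (2^-1 * 'i) : C) = 2^-1 * 'i.
  transitivity (- (conjc (2^-1 : C) * conjc ('i : C))).
    by rewrite -(rmorphM conjc) -(rmorphN conjc).
  by rewrite h2 conjc_i mulrN opprK.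
have trX' : \tr (hconj X) = 0 by rewrite mxtrace_hconj trX rmorph0.
split.
- apply/mem_su; rewrite hconjZ hconjD hconjN hconjK h2 -scalerN opprB.
  by split=> //; rewrite mxtraceZ linearB /= trX trX' subrr mulr0.
- apply/mem_su; rewrite hconjZ h2i hconjD hconjK.
  split; first by rewrite scaleNr opprK addrC.
  by rewrite mxtraceZ mxtraceD trX trX' addr0 mulr0.
rewrite scalerA mulrN mulrCA ['i * _]sqr_i mulrN1 opprK -scalerDr addrACA addNr addr0.
by rewrite -mulr2n -[X *+ 2]scaler_nat scalerA mulVf ?scale1r // pnatr_eq0.
Qed.

Definition complexified (I : {vspace complex_mx R m}) X :=
  exists A B : complex_mx R m, [/\ A \in I, B \in I & X = (A : M) + 'i *: (B : M)].

Lemma complexified_subspace I : is_subspace (complexified I).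
Proof.
split; first by exists 0, 0; split; rewrite ?mem0v // scaler0 addr0.
move=> a _ _ [A [B [IA IB ->]]] [A' [B' [IA' IB' ->]]].
exists (complex.Re a *: A - complex.Im a *: B + A'),
  (complex.Im a *: A + complex.Re a *: B + B').
split.
- by rewrite memvD // memvB // memvZ.
- by rewrite memvD // memvD // memvZ.
rewrite !complex_mx_scaleE {1}(complexE a).
apply/matrixP=> i j; rewrite !mxE.
have im2 : 'i * 'i = -1 :> C := sqr_i R.
move: im2; set im := 'i; set x := (_)%:C; set y := (_)%:C => im2.
have -> : (x + im * y) * ((A : M) i j + im * (B : M) i j) + ((A' : M) i j + im * (B' : M) i j)
  = x * (A : M) i j + (im * im) * (y * (B : M) i j) + (A' : M) i j
    + im * (y * (A : M) i j + x * (B : M) i j + (B' : M) i j) by ring.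
by rewrite im2 mulN1r.
Qed.

Lemma complexified_ideal I T X : lie_ideal (su R m) I ->
  \tr T = 0 -> complexified I X -> complexified I (mx_lie T X).
Proof.
move=> [_ Iid] /traceless_su_decomp[C0 [D [sC sD ->]]] [A [B [IA IB ->]]].
have br S Z : S \in su R m -> Z \in I -> lie S Z \in I by apply/lie_prodP.
exists (lie C0 A - lie D B), (lie C0 B + lie D A).
split; [by rewrite memvB ?br | by rewrite memvD ?br |].
have mDl (S S' Z : M) a : mx_lie (S + a *: S') Z = mx_lie S Z + a *: mx_lie S' Z.
  by rewrite addrC mx_lie_linearl addrC.
have mDr (S S' Z : M) a : mx_lie Z (S + a *: S') = mx_lie Z S + a *: mx_lie Z S'.
  by rewrite addrC mx_lie_linearr addrC.
have lieE Z W : lie Z W = mx_lie (Z : M) (W : M) :> M by [].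
rewrite mDl !mDr ['i *: (_ + 'i *: _)]scalerDr scalerA ['i * _]sqr_i scaleN1r.
rewrite [X in _ + X = _]addrC addrACA -['i *: _ + _]scalerDr.
by rewrite -!lieE.
Qed.

(** The way back from I + i I to I: in A + i B the Hermitian part is i B, so it
    vanishes when A + i B is skew-Hermitian. *)
Lemma complexified_skew I (X : complex_mx R m) : (I <= su R m)%VS ->
  X \in su R m -> complexified I X -> X \in I.
Proof.
move=> /subvP Isu /mem_su[hX _] [A [B [IA IB XE]]].
have [hA _] := (mem_su A).1 (Isu _ IA); have [hB _] := (mem_su B).1 (Isu _ IB).
suff /eqP : 2 * 'i *: (B : M) = 0.
  rewrite scaler_eq0 mulf_eq0 pnatr_eq0 /= => /orP[|/eqP B0].
    by rewrite eq_complex /= oner_eq0 andbF.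
  by rewrite XE B0 scaler0 addr0.
move: hX; rewrite XE hconjD hconjZ hA hB conjc_i scaleNr scalerN opprK opprD.
by move/addrI/eqP; rewrite -addr_eq0 -mulr2n -scaler_nat scalerA => /eqP.
Qed.

(** Not being abelian is also read off the complexification: the elementary
    matrices E_01 and E_10 do not commute. *)
Lemma su_simple : (2 <= m)%N -> lie_simple (su R m).
Proof.
move=> m2; split; first exact: su_subalg.
  apply/negP=> /eqP su0.
  pose o := Ordinal (ltnW m2); pose p := Ordinal m2.
  have comm X Y : X \in su R m -> Y \in su R m -> mx_lie X Y = 0.
    by move=> sX sY; have := mem_lie_prod sX sY; rewrite su0 memv0 => /eqP.
  have commC X Y : \tr X = 0 -> \tr Y = 0 -> mx_lie X Y = 0.
    move=> /traceless_su_decomp[A [B [sA sB ->]]] /traceless_su_decomp[A' [B' [sA' sB' ->]]].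
    rewrite addrC mx_lie_linearl ![A' + _]addrC !mx_lie_linearr.
    by rewrite !comm // !(scaler0, addr0).
  have /matrixP/(_ o o)/eqP :=
    commC _ _ (@mxtrace_delta _ m o p isT) (@mxtrace_delta _ m p o isT).
  by rewrite /mx_lie !mul_delta_mx !mxE !eqxx /= subr0 oner_eq0.
move=> I Iid; have [->|I0] := eqVneq I 0%VS; [by left | right].
have [Isu _] := Iid; apply/eqP; rewrite eqEsubv Isu; apply/subvP=> X sX.
have IA := memv_pick I; set A := vpick I in IA.
have A0 : A != 0 by rewrite vpick0.
apply: complexified_skew => //; have [_ trX] := (mem_su X).1 sX.
have [_ trA] := (mem_su A).1 (subvP Isu _ IA).
apply: (@sl_ideal_full _ _ _ (complexified_subspace I) _ A) => //.
  by move=> T Y; apply: complexified_ideal.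
by exists A, 0; split; rewrite ?mem0v // scaler0 addr0.
Qed.

Lemma su_perfect : (2 <= m)%N -> lie_prod (su R m) (su R m) = su R m.
Proof.
move=> /su_simple[sub non0 simp].
have [] // := simp (lie_prod (su R m) (su R m)); last by move/eqP; rewrite (negbTE non0).
by split=> //; apply: lie_prodS.
Qed.

Fact skew_subspace : is_subspace (fun A : complex_mx R m => hconj A = - (A : M)).
Proof.
split=> [|a A B hA hB]; first by rewrite /hconj map_mx0 trmx0 oppr0.
by rewrite complex_mx_scaleE hconjD hconjZ conjc_real hA hB opprD scalerN.
Qed.

Definition skewherm : {vspace complex_mx R m} := vspace_of skew_subspace.

Lemma mem_skewherm (X : complex_mx R m) : X \in skewherm <-> hconj X = - (X : M).
Proof. exact: mem_vspace_of. Qed.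

Lemma su_sub_skewherm : (su R m <= skewherm)%VS.
Proof. by apply/subvP=> X /mem_su[hX _]; apply/mem_skewherm. Qed.

Lemma skewherm_derived : (2 <= m)%N -> lie_prod skewherm skewherm = su R m.
Proof.
move=> m2; apply/eqP; rewrite eqEsubv; apply/andP; split.
  by apply/lie_prodP=> X Y /mem_skewherm hX /mem_skewherm hY; apply/mem_su/skew_lie.
by rewrite -{1}(su_perfect m2) lie_prodS ?su_sub_skewherm.
Qed.

End SpecialUnitary.

(** * Linear maps and matrices *)
Lemma linear_lfun (K : fieldType) (U V : vectType K) (f : U -> V) :
  linear f -> {g : 'Hom(U, V) | g =1 f}.
Proof.
move=> fL; pose F := HB.pack_for {linear U -> V} f (GRing.isLinear.Build K U V *:%R f fL).
by exists (linfun F) => x; rewrite lfunE.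
Qed.

Lemma eq_mulmx_cV (K : fieldType) (n : nat) (A B : 'M[K]_n) :
  (forall v : 'cV[K]_n, A *m v = B *m v) -> A = B.
Proof.
move=> AB; apply/matrixP=> i j.
by have /matrixP/(_ i 0) := AB (delta_mx j 0); rewrite -!colE !mxE.
Qed.

Lemma eq_bilinear_mx (K : fieldType) (n : nat) (A B : 'M[K]_n) :
  (forall v w : 'cV[K]_n, (v^T *m A *m w) 0 0 = (v^T *m B *m w) 0 0) -> A = B.
Proof.
move=> AB; apply/matrixP=> i j; have := AB (delta_mx i 0) (delta_mx j 0).
by rewrite !trmx_delta -!colE -!rowE !mxE.
Qed.

Lemma cV_linear_mx (K : fieldType) (n : nat) (f : 'cV[K]_n -> 'cV[K]_n) :
  linear f -> exists A : 'M[K]_n, forall v : 'cV[K]_n, f v = A *m v.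
Proof.
move=> fL; pose g (v : 'rV[K]_n) := (f v^T)^T.
have gL : linear g by move=> a u v; rewrite /g !linearP fL !linearP.
pose G := HB.pack_for {linear 'rV[K]_n -> 'rV[K]_n} g (GRing.isLinear.Build _ _ _ _ g gL).
exists (lin1_mx G)^T => v; rewrite -[v in RHS]trmxK -trmx_mul mul_rV_lin1 /=.
by rewrite /g !trmxK.
Qed.

(** * The Lie algebra s as a realification of u(m) *)
Section OscillatorMatrices.
Variables (R : realType) (m : nat).
Local Notation d := (oscillator R m).
Implicit Types (A B : 'M[R]_(m + m)) (v w : 'cV[R]_(m + m)).

(** Multiplication by i in the coordinates x_1, ..., x_m (real parts) and
    y_1, ..., y_m (imaginary parts). *)
Definition Jmx : 'M[R]_(m + m) := block_mx 0 (- 1%:M) 1%:M 0.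

Lemma osc_rotE v : osc_rot v = Jmx *m v.
Proof.
rewrite /osc_rot -[v in RHS]vsubmxK mul_block_col !mul0mx mulNmx !mul1mx.
by rewrite add0r addr0.
Qed.

Lemma Jmx_sqr : Jmx *m Jmx = - 1%:M.
Proof.
rewrite mulmx_block !mul0mx !mulmx0 !mul1mx mulmx1 !addr0 add0r.
by rewrite scalar_mx_block opp_block_mx oppr0.
Qed.

Lemma Jmx_mulK v : Jmx *m (Jmx *m v) = - v.
Proof. by rewrite mulmxA Jmx_sqr mulNmx mul1mx. Qed.

Lemma Jmx_tr : Jmx^T = - Jmx.
Proof. by rewrite tr_block_mx !linear0 linearN /= trmx1 opp_block_mx oppr0 opprK. Qed.

Lemma osc_sympE v w : osc_symp v w = ((Jmx *m v)^T *m w) 0 0.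
Proof.
rewrite -osc_rotE mxE big_split_ord /= /osc_symp -big_split /=.
by apply: eq_bigr => i _; rewrite ![_^T _ _]mxE osc_rotEl osc_rotEr; ring.
Qed.

Lemma V_act_comp A B : (V_act A \o V_act B)%VF = V_act (A *m B).
Proof.
apply/lfunP=> u; rewrite comp_lfunE !lfunE.
by apply: osc_eq; rewrite // /vcoord /= mulmxA.
Qed.

Lemma V_act_lie A B : lie (V_act A : 'End(d)) (V_act B) = V_act (mx_lie A B).
Proof.
rewrite -[LHS]/(end_lie _ _) /end_lie !V_act_comp /mx_lie addrC -scaleN1r -V_actP.
by rewrite scaleN1r addrC.
Qed.

Lemma V_act_inj : injective (@V_act R m).
Proof.
move=> A B AB; apply: eq_mulmx_cV => v.
have /(congr1 (@vcoord R m)) : V_act A (osc 0 v 0) = V_act B (osc 0 v 0) by rewrite AB.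
by rewrite !V_act_coord.
Qed.

(** A coordinate-free description of s, with converse [s_lieP]: commuting with J
    gives the shape of the blocks, and skewness their symmetries. *)
Lemma mem_s_lie A : A^T = - A -> A *m Jmx = Jmx *m A -> V_act A \in s_lie R m.
Proof.
rewrite -[A]submxK; set a := ulsubmx A; set b := ursubmx A.
set c := dlsubmx A; set e := drsubmx A.
rewrite tr_block_mx opp_block_mx => /eq_block_mx[aT cT bT eT].
rewrite !mulmx_block !mulmx0 !mul0mx !mulmxN !mulNmx !mul1mx !mulmx1 !addr0 !add0r.
move=> /eq_block_mx[bc ae _ _]; apply/mem_vspace_of; exists a, b; split=> //.
  by rewrite bT bc.
by congr (V_act (block_mx _ _ _ _)); [rewrite bc opprK | apply: oppr_inj].
Qed.

(** Left multiplication by [X] on C^m = R^m + i R^m.  With X = M - i P this is the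
    block matrix of rows (M, P) and (- P, M) that defines s. *)
Definition realify (X : complex_mx R m) : 'M[R]_(m + m) :=
  block_mx (map_mx (@complex.Re R) X) (- map_mx (@complex.Im R) X)
           (map_mx (@complex.Im R) X) (map_mx (@complex.Re R) X).

Lemma realifyP (a : R) (X Y : complex_mx R m) :
  realify (a *: X + Y) = a *: realify X + realify Y.
Proof.
rewrite /realify scale_block_mx add_block_mx; congr block_mx;
  apply/matrixP=> i j; rewrite complex_mx_scaleE !mxE;
  by case: (X i j) (Y i j) => [x y] [x' y'] /=; ring.
Qed.

Lemma realifyM (X Y : 'M[R[i]]_m) : realify (X *m Y) = realify X *m realify Y.
Proof.
rewrite /realify mulmx_block !mulNmx !mulmxN.
have ReM : map_mx (@complex.Re R) (X *m Y) =
    map_mx (@complex.Re R) X *m map_mx (@complex.Re R) Y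
    - map_mx (@complex.Im R) X *m map_mx (@complex.Im R) Y.
  apply/matrixP=> i j; rewrite !mxE raddf_sum -sumrB; apply: eq_bigr => k _.
  by rewrite !mxE; case: (X i k) (Y k j) => [x y] [x' y'].
have ImM : map_mx (@complex.Im R) (X *m Y) =
    map_mx (@complex.Re R) X *m map_mx (@complex.Im R) Y
    + map_mx (@complex.Im R) X *m map_mx (@complex.Re R) Y.
  apply/matrixP=> i j; rewrite !mxE raddf_sum -big_split; apply: eq_bigr => k _.
  by rewrite !mxE; case: (X i k) (Y k j) => [x y] [x' y'].
by rewrite ReM ImM opprD [in RHS]addrC; congr block_mx; rewrite addrC.
Qed.

Lemma realify_lie (X Y : complex_mx R m) :
  realify (lie X Y) = mx_lie (realify X) (realify Y).
Proof.
rewrite /mx_lie -!realifyM -[lie X Y]/(X *m Y - Y *m X : 'M[R[i]]_m) addrC.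
have := realifyP (-1) (Y *m X : 'M[R[i]]_m) (X *m Y : 'M[R[i]]_m).
by rewrite !scaleN1r => ->; rewrite addrC.
Qed.

Lemma realify_inj : injective realify.
Proof.
move=> X Y /eq_block_mx[/matrixP reXY _ /matrixP imXY _]; apply/matrixP=> i j.
have := reXY i j; have := imXY i j; rewrite !mxE.
by case: (X i j) (Y i j) => [x y] [x' y'] /= -> ->.
Qed.

Definition cact_fun (X : complex_mx R m) : 'End(d) := V_act (realify X).

Fact cact_linear : linear cact_fun.
Proof. by move=> a X Y; rewrite /cact_fun realifyP V_actP. Qed.

Definition cact : 'Hom(complex_mx R m, 'End(d)) := sval (linear_lfun cact_linear).

Lemma cactE X : cact X = V_act (realify X).
Proof. exact: (svalP (linear_lfun cact_linear)). Qed.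

Lemma cact_lie X Y : cact (lie X Y) = lie (cact X) (cact Y).
Proof. by rewrite !cactE V_act_lie realify_lie. Qed.

Lemma cact_inj : injective cact.
Proof. by move=> X Y; rewrite !cactE => /V_act_inj/realify_inj. Qed.

Lemma cact_skewherm X : X \in skewherm R m -> cact X \in s_lie R m.
Proof.
move=> /mem_skewherm hX; rewrite cactE.
apply: (proj2 (mem_vspace_of (s_subspace R m) (V_act (realify X)))).
exists (map_mx (@complex.Re R) X), (- map_mx (@complex.Im R) X).
split; last by rewrite opprK.
  apply/matrixP=> i j; have /matrixP/(_ i j) := hX; rewrite !mxE;
  by case: (X i j) (X j i) => [x y] [x' y'] /eqP;
  rewrite eq_complex /= => /andP[/eqP reX /eqP imX].
apply/matrixP=> i j; have /matrixP/(_ i j) := hX; rewrite !mxE;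
by case: (X i j) (X j i) => [x y] [x' y'] /eqP;
  rewrite eq_complex /= => /andP[/eqP reX /eqP imX].
Qed.

Lemma s_lie_cact f : f \in s_lie R m -> exists2 X, X \in skewherm R m & f = cact X.
Proof.
move=> /(proj1 (mem_vspace_of (s_subspace R m) f))[A [P [hA hP ->]]].
pose X : complex_mx R m := \matrix_(i, j) Complex (A i j) (- P i j).
exists X.
  apply/mem_skewherm/matrixP=> i j; rewrite !mxE /=.
  have /matrixP/(_ i j) := hA; have /matrixP/(_ i j) := hP; rewrite !mxE => -> ->.
  by apply/eqP; rewrite eq_complex /= !eqxx.
rewrite cactE /realify; congr (V_act (block_mx _ _ _ _));
  by apply/matrixP=> i j; rewrite !mxE /= ?opprK.
Qed.

Lemma s_lieE : s_lie R m = (cact @: skewherm R m)%VS.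
Proof.
apply/eqP; rewrite eqEsubv; apply/andP; split; apply/subvP=> f.
  by move=> /s_lie_cact[X uX ->]; apply: memv_img.
by move=> /memv_imgP[X uX ->]; apply: cact_skewherm.
Qed.

Definition ract_fun (A : 'M[R]_m) : 'End(d) := V_act (block_mx A 0 0 A).

Fact ract_linear : linear ract_fun.
Proof.
by move=> a X Y; rewrite /ract_fun -V_actP scale_block_mx add_block_mx scaler0 addr0.
Qed.

Lemma s0_isomorphic : lie_isomorphic (s0_lie R m) (so R m).
Proof.
have [f fE'] := linear_lfun ract_linear.
have fE X : f X = V_act (block_mx X 0 0 X) by rewrite fE'.
have -> : s0_lie R m = (f @: so R m)%VS.
  apply/eqP; rewrite eqEsubv; apply/andP; split; apply/subvP=> g.
    by move=> /mem_vspace_of[X [/mem_so hX ->]]; rewrite -fE memv_img.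
  move=> /memv_imgP[X /mem_so hX ->]; rewrite fE; apply/mem_vspace_of.
  by exists X.
apply: limg_isomorphic; last exact: so_subalg.
  by move=> X Y; rewrite !fE => /V_act_inj/eq_block_mx[].
move=> X Y _ _; rewrite !fE V_act_lie /mx_lie !mulmx_block !mul0mx !mulmx0.
by rewrite opp_block_mx add_block_mx !(add0r, addr0) oppr0.
Qed.

(** This rests on su(m) being perfect, hence on its simplicity. *)
Lemma s_derived : (2 <= m)%N ->
  lie_prod (s_lie R m) (s_lie R m) = (cact @: su R m)%VS.
Proof.
move=> m2; rewrite s_lieE -(skewherm_derived R m2).
symmetry; apply: (@limg_lie_prod R (complex_mx R m) 'End(d) cact).
by move=> X Y _ _; apply: cact_lie.
Qed.

Lemma s_derived_isomorphic : (2 <= m)%N ->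
  lie_isomorphic (lie_prod (s_lie R m) (s_lie R m)) (su R m).
Proof.
move=> m2; rewrite s_derived //; apply: limg_isomorphic cact_inj _ (su_subalg R m).
by move=> X Y _ _; apply: cact_lie.
Qed.

End OscillatorMatrices.

(** * Decomposition of a derivation *)
Section OscillatorDerivations.
Variables (R : realType) (m : nat).
Local Notation d := (oscillator R m).
Local Notation J := (Jmx R m).
Implicit Types (A B : 'M[R]_(m + m)) (v w : 'cV[R]_(m + m)).

Lemma osc_lieE a v c b w e : lie (osc a v c : d) (osc b w e) =
  osc 0 (a *: (J *m w) - b *: (J *m v)) (((J *m v)^T *m w) 0 0).
Proof. by rewrite -osc_sympE -!osc_rotE. Qed.

Lemma oscE (u : d) : u = osc (dcoord u) (vcoord u) (zcoord u).
Proof. exact: osc_eq. Qed.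

Lemma osc_add a v c b w e :
  osc a v c + osc b w e = osc (a + b) (v + w) (c + e) :> d.
Proof. by []. Qed.

Lemma osc_scale x a v c :
  x *: osc a v c = osc (x * a) (x *: v) (x * c) :> d.
Proof. by []. Qed.

Lemma lie_deltaE b w e : lie (osc 1 0 0 : d) (osc b w e) = osc 0 (J *m w) 0.
Proof. by rewrite osc_lieE scale1r mulmx0 scaler0 subr0 trmx0 mul0mx mxE. Qed.

Lemma D100E a v c : D100 R m (osc a v c) = osc 0 0 a.
Proof. by rewrite lfunE. Qed.

Lemma D012E a v c : D012 R m (osc a v c) = osc 0 v (2 * c).
Proof. by rewrite lfunE. Qed.

Lemma Jmx_skew v w : (J *m v)^T *m w = - (v^T *m (J *m w)).
Proof. by rewrite trmx_mul Jmx_tr mulmxN mulNmx -mulmxA. Qed.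

Lemma D100_derivation : is_derivation (D100 R m).
Proof.
move=> u w; rewrite D100_lie (oscE u) (oscE w) !D100E !osc_lieE osc_add.
rewrite !mulmx0 !scale0r !scaler0 trmx0 mul0mx !mxE.
by rewrite !(subr0, addr0).
Qed.

Lemma D012_derivation : is_derivation (D012 R m).
Proof.
move=> u w; rewrite (oscE u) (oscE w) osc_lieE !D012E !osc_lieE osc_add.
rewrite !scale0r sub0r subr0 addr0 addrC; congr osc; by rewrite mulr_natl.
Qed.

Lemma V_act_derivation A : A^T = - A -> A *m J = J *m A -> is_derivation (V_act A).
Proof.
move=> AT AJ u w; rewrite (oscE u) (oscE w) osc_lieE !V_act_coord !osc_lieE osc_add.
rewrite !scale0r sub0r subr0 addr0; congr osc.
  by rewrite mulmxBr -!scalemxAr !mulmxA AJ addrC.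
have -> : (J *m (A *m vcoord u))^T = - ((J *m vcoord u)^T *m A).
  by rewrite mulmxA -AJ -mulmxA trmx_mul AT mulmxN.
by rewrite mulNmx -mulmxA mxE addNr.
Qed.

(** Applying [D] to brackets determines its components one after the other: z is a
    bracket and is central, which gives [D z = mu z]; the brackets [delta, v] give
    the commutation of [A] with J and the z-component [l] on V; the brackets
    [v, w] give the symmetric part of [A]. *)
Lemma derivation_decomp (D : 'End(d)) : (0 < m)%N -> is_derivation D ->
  exists (c k : R) A (w : d), [/\ A^T = - A, A *m J = J *m A
    & D = c *: D100 R m + k *: D012 R m + V_act A + ad w].
Proof.
move=> m0 dD; have JJ : J *m J = - 1%:M := Jmx_sqr R m.
have Jreg X Y : X *m J = Y *m J -> X = Y.
  move=> /(congr1 (mulmx^~ J)); rewrite -!mulmxA JJ !mulmxN !mulmx1.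
  exact: oppr_inj.
have JJv := @Jmx_mulK R m.
pose V v : d := osc 0 v 0; pose delta : d := osc 1 0 0; pose z : d := osc 0 0 1.
have [a [e [c De]]] : exists a e c, D delta = osc a e c.
  by exists (dcoord (D delta)), (vcoord (D delta)), (zcoord (D delta)); apply: oscE.
have [mu Dz] : exists mu, D z = osc 0 0 mu.
  exists (zcoord (D z)).
  have dz : dcoord (D z) = 0.
    pose o := Ordinal m0; have -> : z = lie (osc_x R o) (osc_y R o) by rewrite lie_x_y eqxx.
    by rewrite dD /dcoord /= addr0.
  rewrite {1}(oscE (D z)) dz; congr osc.
  have : lie (D z) delta = 0.
    have := dD z delta; rewrite /z /delta !lie_z addr0 linear0.
    by move<-.
  rewrite (oscE (D z)) osc_lieE dz => /(congr1 (@vcoord R m)).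
  rewrite [vcoord _]/= [vcoord 0]/= scale0r scale1r sub0r => /eqP; rewrite oppr_eq0 => /eqP Jp.
  by apply: oppr_inj; rewrite -JJv Jp mulmx0 oppr0.
have lie_delta v : lie delta (V v) = V (J *m v).
  by rewrite /delta /V lie_deltaE.
have VJ v : V v = lie delta (V (- (J *m v))).
  by rewrite lie_delta mulmxN JJv opprK.
have dV v : dcoord (D (V v)) = 0.
  by rewrite VJ dD /dcoord /= addr0.
have VP b v w : V (b *: v + w) = b *: V v + V w.
  by rewrite /V osc_scale osc_add !mulr0 !addr0.
have [A AE] : exists A : 'M[R]_(m + m), forall v, vcoord (D (V v)) = A *m v.
  by apply: cV_linear_mx => b v w; rewrite VP linearP.
pose l v := zcoord (D (V v)).
have DV v : D (V v) = osc 0 (A *m v) (l v).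
  by rewrite (oscE (D (V v))) dV AE.
have rel v : osc 0 (A *m (J *m v)) (l (J *m v)) =
    osc 0 (a *: (J *m v) + J *m (A *m v)) (((J *m e)^T *m v) 0 0) :> d.
  by rewrite -DV -lie_delta dD De DV /V /delta lie_deltaE osc_lieE osc_add scale0r subr0 !addr0.
have AJ : A *m J = a *: J + J *m A.
  apply: eq_mulmx_cV => v; have /(congr1 (@vcoord R m)) := rel v.
  by rewrite /vcoord /= mulmxDl -scalemxAl -!mulmxA.
have lJ v : l (J *m v) = ((J *m e)^T *m v) 0 0 by have /(congr1 (@zcoord R m)) := rel v.
(* In A J J = a J J + J A J, the two products involving A have the same trace. *)
have a0 : a = 0.
  have trJAJ : \tr (J *m A *m J) = - \tr A.
    by rewrite mxtrace_mulC mulmxA JJ mulNmx mul1mx linearN.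
  have trAJJ : \tr (A *m J *m J) = - \tr A.
    by rewrite -mulmxA JJ mulmxN mulmx1 linearN.
  move: trAJJ; rewrite AJ mulmxDl linearD /= trJAJ -[RHS]add0r => /addIr.
  rewrite -scalemxAl JJ linearZ /= linearN /= mxtrace1 mulrN => /eqP.
  by rewrite oppr_eq0 mulf_eq0 pnatr_eq0 addn_eq0 andbb gtn_eqF // orbF => /eqP.
have {}AJ : A *m J = J *m A by rewrite AJ a0 scale0r add0r.
have AT : A^T + A = mu%:M.
  have E : (J *m A)^T + J^T *m A = mu *: J^T.
    apply: eq_bilinear_mx => v w.
    have Dlie : D (lie (V v) (V w)) = osc 0 0 (((J *m v)^T *m w) 0 0 * mu).
      have zE x : osc 0 0 x = x *: z by rewrite osc_scale mulr0 scaler0 mulr1.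
      rewrite osc_lieE !scale0r subrr [in LHS]zE linearZ /= Dz.
      by rewrite osc_scale mulr0 scaler0.
    have /(congr1 (@zcoord R m)) := dD (V v) (V w).
    rewrite Dlie !DV !osc_lieE osc_add /zcoord /= mulrC !mulmxA !trmx_mul => E.
    by rewrite mulmxDr mulmxDl -scalemxAr -scalemxAl [LHS]mxE [RHS]mxE E !mulmxA.
  apply: Jreg; rewrite mulmxDl mul_scalar_mx.
  move: E; rewrite trmx_mul Jmx_tr mulmxN mulNmx scalerN -opprD => /oppr_inj.
  by rewrite AJ.
(* D_{0,1,2} contributes 1 on V and 2 on z, whence the coefficient mu / 2; and
   V (J e) is chosen so that [V (J e), delta] = - J J e = e. *)
exists c, (mu / 2), (A - (mu / 2)%:M), (V (J *m e)); split.
- have AT' : A^T = (mu / 2)%:M + (mu / 2)%:M - A.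
    apply/(addIr A); rewrite AT subrK -raddfD; congr (_%:M); by field.
  by rewrite linearB /= tr_scalar_mx AT' opprB addrAC addrK.
- by rewrite mulmxBl mulmxBr AJ scalar_mxC.
apply/lfunP=> u.
have uE : u = dcoord u *: delta + V (vcoord u) + zcoord u *: z.
  rewrite [LHS]oscE /delta /V /z !osc_scale !osc_add.
  by rewrite !mulr0 !scaler0 !mulr1 !addr0 !add0r.
rewrite [in LHS]uE [LHS]linearD [X in X + _ = _]linearD /= !linearZ /= De Dz DV.
rewrite [in RHS](oscE u) !add_lfunE !scale_lfunE D100E D012E V_act_coord adE osc_lieE.
move: (dcoord u) (vcoord u) (zcoord u) => x v y.
rewrite !osc_scale; apply: osc_eq; rewrite /dcoord /vcoord /zcoord /=.
- by rewrite a0 !mulr0 !addr0.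
- rewrite JJv scale0r sub0r scalerN opprK !scaler0 mulmxBl mul_scalar_mx !addr0 !add0r.
  by rewrite subrKC addrC.
- rewrite JJv linearN mulNmx addr0 [X in _ = _ + X]mxE.
  have -> : l v = - (e^T *m v) 0 0.
    by rewrite -[v in LHS]opprK -JJv lJ Jmx_skew JJv opprK mxE.
  by field.
Qed.

End OscillatorDerivations.

(** * Direct sums *)
Lemma directv_add3 (K : fieldType) (E : vectType K) (U V W : {vspace E}) :
    (forall u v w, u \in U -> v \in V -> w \in W -> u + v + w = 0 ->
      [/\ u = 0, v = 0 & w = 0]) ->
  directv (U + V + W).
Proof.
move=> indep; rewrite !directv_addE /= !directv_trivial /=.
apply/andP; split; rewrite -subv0; apply/subvP=> t /memv_capP[].
  rewrite -memvN => Ut Vt; have [] := indep (- t) t 0 Ut Vt (mem0v _).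
    by rewrite addNr addr0.
  by move=> _ -> _; apply: mem0v.
move=> /memv_addP[u Uu [v Vv ->]]; rewrite -memvN => Ww.
by have [|-> -> _] := indep u v _ Uu Vv Ww; rewrite ?subrr // addr0 mem0v.
Qed.

Lemma directv_add4 (K : fieldType) (E : vectType K) (U V W T : {vspace E}) :
    (forall u v w t, u \in U -> v \in V -> w \in W -> t \in T ->
      u + v + w + t = 0 -> [/\ u = 0, v = 0, w = 0 & t = 0]) ->
  directv (U + V + W + T).
Proof.
move=> indep; have dUVW : directv (U + V + W).
  apply: directv_add3 => u v w Uu Vv Ww uvw0.
  by have [|-> -> -> _] := indep u v w 0 Uu Vv Ww (mem0v _); first by rewrite addr0.
rewrite directv_addE /= dUVW directv_trivial /=.
rewrite -subv0; apply/subvP=> t /memv_capP[/memv_addP[x /memv_addP[u Uu [v Vv ->]] [w Ww ->]]].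
rewrite -memvN => Tt.
by have [|-> -> -> _] := indep u v w _ Uu Vv Ww Tt; rewrite ?subrr // !addr0 mem0v.
Qed.

(** * Spanning and independence of the summands *)
Section OscillatorStructure.
Variables (R : realType) (m : nat).
Local Notation d := (oscillator R m).
Local Notation J := (Jmx R m).
Implicit Types (A B : 'M[R]_(m + m)) (v w : 'cV[R]_(m + m)).

Definition scalar_i : complex_mx R m := ('i)%:M.

Lemma realify_scalar_i : realify scalar_i = J.
Proof.
have re0 : map_mx (@complex.Re R) scalar_i = 0.
  by apply/matrixP=> i j; rewrite !mxE; case: eqP.
have im1 : map_mx (@complex.Im R) scalar_i = 1%:M.
  by apply/matrixP=> i j; rewrite !mxE; case: eqP.
by rewrite /realify re0 im1.
Qed.

(** As z is central, ad only sees the delta- and V-components; ad delta acts as an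
    element of s. *)
Lemma ad_oscE a v c : ad (osc a v c : d) = a *: V_act J + ad (osc 0 v 0).
Proof.
apply/lfunP=> u; rewrite (oscE u) add_lfunE scale_lfunE !adE V_act_coord !osc_lieE.
by rewrite osc_scale osc_add mulr0 scale0r sub0r !addr0 add0r.
Qed.

Lemma ad_osc0 : ad (osc 0 0 0 : d) = 0.
Proof. exact: ad0. Qed.

Lemma cact_scalar_i : cact R m scalar_i = ad (osc 1 0 0 : d).
Proof.
by rewrite cactE realify_scalar_i ad_oscE scale1r ad_osc0 addr0.
Qed.

(** u(m) is the sum of su(m) and of the real multiples of i, and i acts as
    ad delta. *)
Lemma s_lie_sub : (0 < m)%N -> (s_lie R m <= cact R m @: su R m + Inner d)%VS.
Proof.
move=> m0; apply/subvP=> f /s_lie_cact[X uX ->].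
pose t := complex.Im (\tr (X : 'M[R[i]]_m)) / m%:R.
pose Y : complex_mx R m := X - t *: scalar_i.
have XY : X = Y + t *: scalar_i by rewrite subrK.
have sY : Y \in su R m.
  have hX := (mem_skewherm X).1 uX.
  have hI : hconj scalar_i = - (scalar_i : 'M[R[i]]_m).
    apply/matrixP=> i j; rewrite !mxE eq_sym; case: eqP => _.
      by rewrite !mulr1n conjc_i.
    by rewrite !mulr0n rmorph0 oppr0.
  have uY : Y \in skewherm R m.
    by apply: memvB => //; apply: memvZ; apply/mem_skewherm.
  apply/mem_su; split; first by apply/mem_skewherm.
  have := mxtrace_hconj (X : 'M[R[i]]_m); rewrite hX linearN /= => trX.
  rewrite /Y linearB /= complex_mx_scaleE mxtraceZ mxtrace_scalar.
  move: trX; rewrite /t; case: (\tr _) => x y /eqP; rewrite eq_complex /= => /andP[/eqP xN _].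
  (* The trace of a skew-Hermitian matrix is purely imaginary. *)
  have -> : x = 0.
    apply/eqP; rewrite -[_ == 0]orFb -[false]/(2 == 0)%N -mulrn_eq0.
    by rewrite mulr2n -{1}xN addNr.
  have -> : Complex 0 y = y%:C * 'i.
    by rewrite [LHS]complexE /= rmorph0 add0r mulrC.
  rewrite -['i *+ m]mulr_natr mulrCA.
  rewrite -(rmorph_nat (real_complex R)) -rmorphM divfK ?pnatr_eq0 -?lt0n //.
  by rewrite mulrC subrr.
rewrite XY linearD linearZ /= cact_scalar_i.
apply: memv_add; first exact: memv_img.
by apply: memvZ; apply: mem_Inner.
Qed.

Lemma s_lieP f : f \in s_lie R m ->
  exists A, [/\ A^T = - A, A *m J = J *m A & f = V_act A].
Proof.
move=> /(proj1 (mem_vspace_of (s_subspace R m) f))[M [P [hM hP ->]]].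
exists (block_mx M P (- P) M); split=> //.
  by rewrite tr_block_mx opp_block_mx linearN /= hM hP opprK.
rewrite !mulmx_block !mulmx0 !mul0mx !mulmxN !mulNmx !mul1mx !mulmx1.
by rewrite !(add0r, addr0) opprK.
Qed.

Lemma V_act_J_s : V_act J \in s_lie R m.
Proof. by apply: mem_s_lie; rewrite ?Jmx_tr. Qed.

Lemma s_sub_Der : (s_lie R m <= Der d)%VS.
Proof.
apply/subvP=> f /s_lieP[A [AT AJ ->]]; apply/mem_vspace_of.
exact: V_act_derivation.
Qed.

Lemma cact_su_sub : (cact R m @: su R m <= s_lie R m)%VS.
Proof. by rewrite s_lieE limgS // su_sub_skewherm. Qed.

Lemma Der_oscillator : (0 < m)%N ->
  Der d = (<[D100 R m]> + <[D012 R m]> + cact R m @: su R m + Inner d)%VS.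
Proof.
move=> m0; apply/eqP; rewrite eqEsubv; apply/andP; split.
  apply/subvP=> D /(proj1 (mem_vspace_of _ D)) /(derivation_decomp m0).
  move=> [c [k [A [w [AT AJ ->]]]]].
  have /memv_addP[f fU [g gI ->]] := subvP (s_lie_sub m0) _ (mem_s_lie AT AJ).
  have -> (p q : 'End(d)) : p + q + (f + g) + ad w = p + q + f + (g + ad w).
    by rewrite !addrA.
  apply: memv_add; last by rewrite memvD ?mem_Inner.
  by apply: memv_add fU; apply: memv_add; apply: memvZ; apply: memv_line.
rewrite !subv_add Inner_sub_Der (subv_trans cact_su_sub s_sub_Der) !andbT.
apply/andP; split; apply/subvP=> _ /vlineP[a ->]; apply: memvZ; apply/mem_vspace_of.
  exact: D100_derivation.
exact: D012_derivation.
Qed.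

(** The value at z isolates [b], the value at delta isolates [a] and the V-component
    of [w]; on V there remains that the realification of [X] is a multiple of J,
    so that [X] is a multiple of i, and it vanishes since its trace does. *)
Lemma Der_oscillator_indep a b X (w : d) : (0 < m)%N -> X \in su R m ->
    a *: D100 R m + b *: D012 R m + cact R m X + ad w = 0 ->
  [/\ a = 0, b = 0, cact R m X = 0 & ad w = 0].
Proof.
move=> m0 /mem_su[_ trX]; rewrite cactE (oscE w).
move: (dcoord w) (vcoord w) (zcoord w) => t v c.
rewrite ad_oscE => /lfunP D0.
have Dat x u y : osc 0 ((b *: u + realify X *m u + t *: (J *m u)) - x *: (J *m v))
    (a * x + b * (2 * y) + ((J *m v)^T *m u) 0 0) = 0 :> d.
  have := D0 (osc x u y); rewrite zero_lfunE => E; apply: etrans E.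
  rewrite !add_lfunE !scale_lfunE D100E D012E !V_act_coord adE osc_lieE.
  rewrite !osc_scale !osc_add; apply: osc_eq; rewrite /dcoord /vcoord /zcoord /=.
  - by rewrite !mulr0 !addr0.
  - by rewrite scale0r sub0r scaler0 add0r !addrA.
  - by rewrite mulr0 !add0r addr0.
have b0 : b = 0.
  have /(congr1 (@zcoord R m)) := Dat 0 0 1.
  rewrite /zcoord /= mulmx0 mxE mulr0 add0r addr0 mulr1 => /eqP.
  by rewrite mulf_eq0 pnatr_eq0 orbF => /eqP.
have a0 : a = 0.
  have /(congr1 (@zcoord R m)) := Dat 1 0 0.
  by rewrite /zcoord /= mulmx0 mxE !mulr0 !addr0 mulr1.
have v0 : v = 0.
  have /(congr1 (@vcoord R m)) := Dat 1 0 0.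
  rewrite /vcoord /= !mulmx0 !scaler0 !addr0 sub0r scale1r => /eqP.
  rewrite oppr_eq0 => /eqP Jv; by apply: oppr_inj; rewrite -Jmx_mulK Jv mulmx0 oppr0.
have rX : realify X = - t *: J.
  apply: eq_mulmx_cV => u; have /(congr1 (@vcoord R m)) := Dat 0 u 0.
  rewrite /vcoord /= b0 !scale0r add0r subr0 -scalemxAl scaleNr => /eqP.
  by rewrite addr_eq0 => /eqP.
have t0 : t = 0.
  have XE : X = - t *: scalar_i.
    apply: realify_inj; rewrite rX -realify_scalar_i.
    have := realifyP (- t) scalar_i 0; rewrite !addr0 => ->.
    by rewrite /realify !map_mx0 oppr0 block_mx0 addr0.
  move: trX; rewrite XE complex_mx_scaleE mxtraceZ mxtrace_scalar => /eqP.
  rewrite mulf_eq0 mulrn_eq0 eqn0Ngt m0 /= => /orP[|]; rewrite eq_complex /=.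
    by rewrite oppr_eq0 => /andP[/eqP].
  by rewrite oner_eq0 andbF.
split=> //.
  by rewrite rX t0 oppr0 scale0r; apply/lfunP=> u;
  rewrite (oscE u) V_act_coord mul0mx zero_lfunE.
by rewrite t0 v0 scale0r add0r ad_osc0.
Qed.

Lemma osc_formE a v c b w e :
  osc_form (osc a v c) (osc b w e) = (v^T *m w) 0 0 + (a * e + c * b).
Proof. by rewrite /osc_form mxE; congr (_ + _); apply: eq_bigr => k _; rewrite !mxE. Qed.

Lemma osc_formN (u w : d) : osc_form (- u) w = - osc_form u w.
Proof.
have := osc_formPl (-1) u 0 w; rewrite addr0 scaleN1r mulN1r => ->.
have := osc_formPl (-1) 0 0 w; rewrite scaler0 addr0 mulN1r addNr => ->.
by rewrite addr0.
Qed.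

Lemma Inner_sub_Der_form : (Inner d <= Der_form R m)%VS.
Proof.
apply/subvP=> f If; apply/mem_vspace_of; split.
  by apply/mem_Der/(subvP (Inner_sub_Der d)).
move: If => /(proj1 (mem_vspace_of _ _))[x ->] u w.
by rewrite !adE lieC osc_formN osc_form_invariant addNr.
Qed.

Lemma s_sub_Der_form : (s_lie R m <= Der_form R m)%VS.
Proof.
apply/subvP=> _ /s_lieP[A [AT AJ ->]]; apply/mem_vspace_of; split.
  exact: V_act_derivation.
move=> u w; rewrite (oscE u) (oscE w) !V_act_coord !osc_formE trmx_mul AT.
by rewrite !mulmxN mulNmx mulmxA mxE; ring.
Qed.

Fact ad_V_subspace : is_subspace (fun f : 'End(d) => exists v, f = ad (osc 0 v 0 : d)).
Proof.
split; first by exists 0; rewrite ad_osc0.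
move=> a _ _ [v ->] [w ->]; exists (a *: v + w); rewrite -adZ -adD osc_scale osc_add.
by rewrite mulr0 addr0.
Qed.

(** All brackets lie in V + R z, where ad forgets z; conversely each v is the
    bracket [delta, - J v]. *)
Lemma Inner_derivedP f : f \in lie_prod (Inner d) (Inner d) <->
  exists v, f = ad (osc 0 v 0 : d).
Proof.
split=> [fI|[v ->]].
  apply: (proj1 (mem_vspace_of ad_V_subspace _)); move: f fI; apply/subvP/lie_prodP.
  move=> _ _ /(proj1 (mem_vspace_of _ _))[x ->] /(proj1 (mem_vspace_of _ _))[y ->].
  apply/mem_vspace_of; exists (vcoord (lie x y)); rewrite ad_lie.
  by rewrite (oscE (lie x y)) ad_oscE scale0r add0r.
have -> : osc 0 v 0 = lie (osc 1 0 0 : d) (osc 0 (- (J *m v)) 0).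
  by rewrite lie_deltaE mulmxN Jmx_mulK opprK.
by rewrite -ad_lie mem_lie_prod ?mem_Inner.
Qed.

(** A derivation decomposes by [derivation_decomp]; its skewness on the pairs
    (delta, delta) and (delta, z) kills the coefficients of D_{1,0,0} and
    D_{0,1,2}. *)
Lemma Der_form_oscillator : (0 < m)%N ->
  Der_form R m = (s_lie R m + lie_prod (Inner d) (Inner d))%VS.
Proof.
move=> m0; apply/eqP; rewrite eqEsubv; apply/andP; split; last first.
  rewrite subv_add s_sub_Der_form; apply/lie_prodP.
  move=> _ _ /(proj1 (mem_vspace_of _ _))[x ->] /(proj1 (mem_vspace_of _ _))[y ->].
  by rewrite ad_lie; apply: (subvP Inner_sub_Der_form); apply: mem_Inner.
apply/subvP=> D /(proj1 (mem_vspace_of _ D))[/(derivation_decomp m0)].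
move=> [c [k [A [w [AT AJ ->]]]]]; rewrite (oscE w).
move: (dcoord w) (vcoord w) (zcoord w) => t v e sk.
have Dat x u y : (c *: D100 R m + k *: D012 R m + V_act A + ad (osc t v e : d)) (osc x u y)
   = osc 0 (k *: u + A *m u + (t *: (J *m u) - x *: (J *m v)))
       (c * x + k * (2 * y) + ((J *m v)^T *m u) 0 0).
  rewrite !add_lfunE !scale_lfunE D100E D012E !V_act_coord adE osc_lieE.
  rewrite !osc_scale !osc_add; apply: osc_eq; rewrite /dcoord /vcoord /zcoord /=.
  - by rewrite !mulr0 !addr0.
  - by rewrite scaler0 add0r.
  - by rewrite addr0.
have c0 : c = 0.
  have := sk (osc 1 0 0) (osc 1 0 0); rewrite !Dat !osc_formE !mulmx0 trmx0 !mul0mx !mxE.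
  rewrite !(mulr0, mul0r, addr0, add0r, mulr1, mul1r) -mulr2n => /eqP.
  by rewrite mulrn_eq0 => /eqP.
have k0 : k = 0.
  have := sk (osc 1 0 0) (osc 0 0 1); rewrite !Dat !osc_formE !mulmx0 trmx0 !mul0mx !mxE.
  rewrite !(mulr0, mul0r, addr0, add0r, mulr1, mul1r) => /eqP.
  by rewrite mulf_eq0 pnatr_eq0 orbF => /eqP.
rewrite c0 k0 !scale0r !add0r ad_oscE addrA; apply: memv_add.
  by rewrite memvD ?mem_s_lie // memvZ // V_act_J_s.
by apply/Inner_derivedP; exists v.
Qed.

Lemma Der_form_directv :
  directv (s_lie R m + lie_prod (Inner d) (Inner d)).
Proof.
apply/directv_addP/eqP; rewrite -subv0; apply/subvP=> f /memv_capP[].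
move=> /s_lieP[A [_ _ fA]] /Inner_derivedP[v fv].
have : f (osc 1 0 0) = 0 by rewrite fA V_act_coord mulmx0.
rewrite fv adE lieC lie_deltaE => /eqP; rewrite oppr_eq0 => /eqP/(congr1 (@vcoord R m)).
rewrite /vcoord /= => Jv; have -> : v = 0.
  by apply: oppr_inj; rewrite -Jmx_mulK Jv mulmx0 oppr0.
by rewrite ad_osc0 mem0v.
Qed.

Lemma Der_directv : (0 < m)%N ->
  directv (<[D100 R m]> + <[D012 R m]> + cact R m @: su R m + Inner d).
Proof.
move=> m0; apply: directv_add4 => _ _ _ _ /vlineP[a ->] /vlineP[b ->] /memv_imgP[X sX ->]
  /(proj1 (mem_vspace_of _ _))[w ->] /(Der_oscillator_indep m0 sX)[-> -> -> ->].
by rewrite !scale0r.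
Qed.

End OscillatorStructure.

Lemma su1 (R : rcfType) : su R 1 = 0%VS.
Proof.
apply/eqP; rewrite -subv0; apply/subvP=> X /mem_su[_].
rewrite /mxtrace big_ord1 memv0 => X00; apply/eqP/matrixP=> i j.
by rewrite !ord1 X00 mxE.
Qed.

(** * Derivations of the oscillator algebra *)
Theorem theorem2 (R : realType) :
  (forall m : nat, (2 <= m)%N ->
    [/\
      (* (a) *)
      Der (oscillator R m)
        = (<[D100 R m]> + <[D012 R m]> + lie_prod (s_lie R m) (s_lie R m)
            + Inner (oscillator R m))%VS
      /\ directv (<[D100 R m]> + <[D012 R m]>
            + lie_prod (s_lie R m) (s_lie R m) + Inner (oscillator R m)),
      (* (b) *)
      Der_form R m
        = (s_lie R m
            + lie_prod (Inner (oscillator R m)) (Inner (oscillator R m)))%VS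
      /\ directv (s_lie R m
            + lie_prod (Inner (oscillator R m)) (Inner (oscillator R m))),
      lie_isomorphic (lie_prod (s_lie R m) (s_lie R m)) (su R m),
      lie_simple (su R m)
    & (3 <= m)%N ->
      lie_isomorphic (s0_lie R m) (so R m)
      /\ (m <> 4%N -> lie_simple (so R m))])
  /\ [/\ Der (oscillator R 1)
           = (<[D012 R 1]> + <[D100 R 1]> + Inner (oscillator R 1))%VS,
         directv (<[D012 R 1]> + <[D100 R 1]> + Inner (oscillator R 1))
       & Der_form R 1 = Inner (oscillator R 1)].
Proof.
split=> [m m2|].
  have m0 : (0 < m)%N by apply: ltnW.
  split.
  - by rewrite s_derived //; split; [apply: Der_oscillator | apply: Der_directv].
  - by split; [apply: Der_form_oscillator | apply: Der_form_directv].
  - exact: s_derived_isomorphic.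
  - exact: su_simple.
  - move=> m3; split; first exact: s0_isomorphic.
    by apply: so_simple => //; rewrite pnatr_eq0.
have s1 : (s_lie R 1 <= Inner (oscillator R 1))%VS.
  by have := @s_lie_sub R 1 isT; rewrite su1 limg0 add0v.
split.
- have := @Der_oscillator R 1 isT; rewrite su1 limg0 addv0.
  by rewrite [(<[D100 R 1]> + _)%VS]addvC.
- apply: directv_add3 => _ _ _ /vlineP[b ->] /vlineP[a ->]
    /(proj1 (mem_vspace_of _ _))[w ->] bav0.
  have [||-> -> _ ->] := @Der_oscillator_indep R 1 a b 0 w isT; rewrite ?mem0v //.
    by rewrite linear0 addr0 [X in X + _]addrC.
  by rewrite !scale0r.
apply/eqP; rewrite eqEsubv Inner_sub_Der_form andbT Der_form_oscillator // subv_add s1.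
apply/subvP=> _ /Inner_derivedP[v ->]; exact: mem_Inner.
Qed.
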